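(* Let $m\ge4$, let $\mathcal W_1$ be an $m\times m$ quadrilateral labyrinth set in $Q$, and let $L_\infty$ be the associated quadrilateral labyrinth fractal. Then $L_\infty$ is a dendrite, i.e. a locally connected continuum (nonempty compact connected Hausdorff space) containing no simple closed curve.
   Context: Let $Q$ be a convex quadrilateral in $\mathbb{R}^2$. Divide $Q$ into two triangles by its shorter diagonal (either diagonal if they have equal length). Label the vertices $Q_1,Q_2,Q_3,Q_4$ anticlockwise, starting at an endpoint of that diagonal, so that the diagonal is $Q_1Q_3$. Let $\Delta_1$ be the closed triangle $Q_1Q_2Q_3$ and $\Delta_2$ the closed triangle $Q_3Q_4Q_1$. Every $x\in Q$ has a unique representation $x=\sum_{i=1}^4\alpha_iQ_i$, defined as follows. If $x\in\Delta_1$, then $\alpha_4=0$ and $(\alpha_1,\alpha_2,\alpha_3)$ are the barycentric coordinates of $x$ in $\Delta_1$. If $x\in\Delta_2$, then $\alpha_2=0$ and $(\alpha_1,\alpha_3,\alpha_4)$ are the barycentric coordinates of $x$ in $\Delta_2$. For an ordered quadruple $V=(V_1,\dots,V_4)$ define $P_V:Q\to\mathbb{R}^2$ by $P_V(x)=\sum_i\alpha_iV_i$. For an integer $m\ge2$, define the following index sets: - $A_1=\{(k_1,k_2,k_3,0)\in\mathbb{Z}_{\ge0}^4:k_1+k_2+k_3=m-1,\ k_2\ne0\}$, - $A_2=\{(k_1,0,k_3,k_4)\in\mathbb{Z}_{\ge0}^4:k_1+k_3+k_4=m-1,\ k_4\ne0\}$, - $A_3=\{(k_1,0,k_3,0)\in\mathbb{Z}_{\ge0}^4:k_1+k_3=m-1\}$,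 - $A=A_1\cup A_2\cup A_3$. For $k\in A$, let $S_m(k)$ be the quadrilateral with ordered vertices $R_1R_2R_3R_4$ given below. - If $k\in A_1$: $R_1=\frac{(k_1+1)Q_1+k_2Q_2+k_3Q_3}{m}$, $R_2=\frac{k_1Q_1+(k_2+1)Q_2+k_3Q_3}{m}$, $R_3=\frac{k_1Q_1+k_2Q_2+(k_3+1)Q_3}{m}$, $R_4=\frac{(k_1+1)Q_1+(k_2-1)Q_2+(k_3+1)Q_3}{m}$. - If $k\in A_2$: $R_1=\frac{(k_1+1)Q_1+k_3Q_3+k_4Q_4}{m}$, $R_2=\frac{(k_1+1)Q_1+(k_3+1)Q_3+(k_4-1)Q_4}{m}$, $R_3=\frac{k_1Q_1+(k_3+1)Q_3+k_4Q_4}{m}$, $R_4=\frac{k_1Q_1+k_3Q_3+(k_4+1)Q_4}{m}$. - If $k\in A_3$: $R_1=\frac{(k_1+1)Q_1+k_3Q_3}{m}$, $R_2=\frac{k_1Q_1+Q_2+k_3Q_3}{m}$, $R_3=\frac{k_1Q_1+(k_3+1)Q_3}{m}$, $R_4=\frac{k_1Q_1+k_3Q_3+Q_4}{m}$. Let $\mathcal S_m=\{S_m(k):k\in A\}$. For $\mathcal W\subseteq\mathcal S_m$, the graph $\mathcal G(\mathcal W)$ has vertex set $\mathcal W$, with two elements adjacent iff they have a common side. An $m\times m$ quadrilateral labyrinth set ($m\ge4$) is a set $\mathcal W_1\subseteq\mathcal S_m$ satisfying three properties. (1) Tree property: $\mathcal G(\mathcal W_1)$ is a tree. (2) Exit property: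 there is exactly one $(k_1,k_2,0,0)\in A$ with $S_m(k_1,k_2,0,0)\in\mathcal W_1$ and $S_m(0,0,k_2,k_1)\in\mathcal W_1$. There is also exactly one $(k_1,0,0,k_4)\in A$ with $S_m(k_1,0,0,k_4)\in\mathcal W_1$ and $S_m(0,k_1,k_4,0)\in\mathcal W_1$. (3) Corner property: $\mathcal W_1$ contains at most one element of $\{S_m(m-1,0,0,0),S_m(0,0,m-1,0)\}$ and at most one element of $\{S_m(0,m-1,0,0),S_m(0,0,0,m-1)\}$. Define recursively for $n\ge2$: $\mathcal W_n=\{P_{W}(W'):W'\in\mathcal W_1,\ W\in\mathcal W_{n-1}\}$. Here $P_W(W')$ is the quadrilateral whose ordered vertices are the images under $P_W$ of the ordered vertices of $W'$. Let $L_n=\bigcup_{W\in\mathcal W_n}W$ (closed regions). The quadrilateral labyrinth fractal is $L_\infty=\bigcap_{n\ge1}L_n$, with the subspace topology from $\mathbb{R}^2$. *)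

(* Defs.v *)
From mathcomp Require Import all_boot all_order all_algebra.
From mathcomp Require Import all_classical all_reals all_analysis.
From Stdlib Require List.

Set Implicit Arguments.
Unset Strict Implicit.
Unset Printing Implicit Defensive.

Import Order.TTheory GRing.Theory Num.Theory.
Import numFieldNormedType.Exports.
Local Open Scope ring_scope.
Local Open Scope classical_set_scope.

Definition cross (R : realType) (u v : R * R) : R := u.1 * v.2 - u.2 * v.1.

(* twice the signed area of the triangle abc (> 0 iff a,b,c anticlockwise) *)
Definition area2 (R : realType) (a b c : R * R) : R := cross (b - a) (c - a).

Definition sqdist (R : realType) (a b : R * R) : R :=
  (a.1 - b.1) ^+ 2 + (a.2 - b.2) ^+ 2.

Definition triangle (R : realType) (a b c : R * R) : set (R * R) :=
  [set x | exists l1 l2 l3 : R, [/\ 0 <= l1, 0 <= l2, 0 <= l3,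
     l1 + l2 + l3 = 1 & x = l1 *: a + l2 *: b + l3 *: c]].

Definition segment (R : realType) (a b : R * R) : set (R * R) :=
  [set x | exists t : R, [/\ 0 <= t, t <= 1 & x = (1 - t) *: a + t *: b]].

Record quad (R : realType) := Quad {
  qv1 : R * R; qv2 : R * R; qv3 : R * R; qv4 : R * R }.

(* Q1 Q2 Q3 Q4 are the anticlockwise-ordered vertices of a (non-degenerate)
   convex quadrilateral: every three consecutive vertices turn left. *)
Definition convex_ccw (R : realType) (Q : quad R) : Prop :=
  [/\ 0 < area2 (qv1 Q) (qv2 Q) (qv3 Q), 0 < area2 (qv2 Q) (qv3 Q) (qv4 Q),
      0 < area2 (qv3 Q) (qv4 Q) (qv1 Q) & 0 < area2 (qv4 Q) (qv1 Q) (qv2 Q)].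

(* the labeling convention: Q1Q3 is the shorter diagonal (or either one if
   the diagonals have the same length) *)
Definition shorter_diag13 (R : realType) (Q : quad R) : Prop :=
  sqdist (qv1 Q) (qv3 Q) <= sqdist (qv2 Q) (qv4 Q).

(* closed region of a quadrilateral V1V2V3V4 split by its diagonal V1V3:
   triangle V1V2V3 union triangle V3V4V1 (for Q this is Delta_1 u Delta_2) *)
Definition region (R : realType) (V : quad R) : set (R * R) :=
  triangle (qv1 V) (qv2 V) (qv3 V) `|` triangle (qv3 V) (qv4 V) (qv1 V).

Definition side (R : realType) (V : quad R) (i : nat) : set (R * R) :=
  match i with
  | 0 => segment (qv1 V) (qv2 V)
  | 1 => segment (qv2 V) (qv3 V)
  | 2 => segment (qv3 V) (qv4 V)
  | _ => segment (qv4 V) (qv1 V)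
  end.

Definition common_side (R : realType) (V W : quad R) : Prop :=
  exists i j : nat, (i < 4)%N /\ (j < 4)%N /\ side V i = side W j.

Definition bary1 (R : realType) (Q : quad R) (x : R * R) : R * R * R :=
  let D := area2 (qv1 Q) (qv2 Q) (qv3 Q) in
  (area2 x (qv2 Q) (qv3 Q) / D, area2 (qv1 Q) x (qv3 Q) / D,
   area2 (qv1 Q) (qv2 Q) x / D).

Definition bary2 (R : realType) (Q : quad R) (x : R * R) : R * R * R :=
  let D := area2 (qv3 Q) (qv4 Q) (qv1 Q) in
  (area2 x (qv4 Q) (qv1 Q) / D, area2 (qv3 Q) x (qv1 Q) / D,
   area2 (qv3 Q) (qv4 Q) x / D).

Definition in_delta1 (R : realType) (Q : quad R) (x : R * R) : bool :=
  let: (a1, a2, a3) := bary1 Q x in [&& 0 <= a1, 0 <= a2 & 0 <= a3].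

Definition PV (R : realType) (Q V : quad R) (x : R * R) : R * R :=
  if in_delta1 Q x then
    let: (a1, a2, a3) := bary1 Q x in
    a1 *: qv1 V + a2 *: qv2 V + a3 *: qv3 V
  else
    let: (a3, a4, a1) := bary2 Q x in
    a1 *: qv1 V + a3 *: qv3 V + a4 *: qv4 V.

Definition Pquad (R : realType) (Q W W' : quad R) : quad R :=
  Quad (PV Q W (qv1 W')) (PV Q W (qv2 W')) (PV Q W (qv3 W')) (PV Q W (qv4 W')).

Definition inA (m : nat) (k : nat * nat * nat * nat) : Prop :=
  let: (k1, k2, k3, k4) := k in
  (k1 + k2 + k3 + k4 = m - 1)%N /\ (k2 = 0%N \/ k4 = 0%N).

Definition comb (R : realType) (Q : quad R) (m : nat) (a1 a2 a3 a4 : nat)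
  : R * R :=
  (m%:R)^-1 *: (a1%:R *: qv1 Q + a2%:R *: qv2 Q + a3%:R *: qv3 Q
                + a4%:R *: qv4 Q).

Definition Sm (R : realType) (Q : quad R) (m : nat) (k : nat * nat * nat * nat)
  : quad R :=
  let: (k1, k2, k3, k4) := k in
  if (k4 == 0)%N && (k2 != 0)%N then
    Quad (comb Q m k1.+1 k2 k3 0) (comb Q m k1 k2.+1 k3 0)
         (comb Q m k1 k2 k3.+1 0) (comb Q m k1.+1 k2.-1 k3.+1 0)
  else if (k2 == 0)%N && (k4 != 0)%N then
    Quad (comb Q m k1.+1 0 k3 k4) (comb Q m k1.+1 0 k3.+1 k4.-1)
         (comb Q m k1 0 k3.+1 k4) (comb Q m k1 0 k3 k4.+1)
  else
    Quad (comb Q m k1.+1 0 k3 0) (comb Q m k1 1 k3 0)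
         (comb Q m k1 0 k3.+1 0) (comb Q m k1 0 k3 1).

Definition Sset (R : realType) (Q : quad R) (m : nat) : set (quad R) :=
  [set Sm Q m k | k in inA m].

Definition adjacent (R : realType) (V W : quad R) : Prop :=
  V <> W /\ common_side V W.

Fixpoint adj_path (R : realType) (x : quad R) (p : seq (quad R)) : Prop :=
  match p with
  | [::] => True
  | y :: p' => adjacent x y /\ adj_path y p'
  end.

Definition graph_connected (R : realType) (Ws : set (quad R)) : Prop :=
  forall x y, Ws x -> Ws y ->
    exists p : seq (quad R), [/\ adj_path x p, (forall z, List.In z p -> Ws z)
                                & last x p = y].

Definition has_cycle (R : realType) (Ws : set (quad R)) : Prop :=
  exists (x : quad R) (p : seq (quad R)),
    [/\ (2 <= size p)%N, List.NoDup (x :: p), (forall z, List.In z (x :: p) -> Ws z),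
        adj_path x p & adjacent (last x p) x].

Definition is_tree (R : realType) (Ws : set (quad R)) : Prop :=
  Ws !=set0 /\ graph_connected Ws /\ ~ has_cycle Ws.

Definition labyrinth_set (R : realType) (Q : quad R) (m : nat)
  (W1 : set (quad R)) : Prop :=
  [/\ (4 <= m)%N, W1 `<=` Sset Q m,
      is_tree W1,
      (exists! p : nat * nat, inA m (p.1, p.2, 0, 0)%N /\
         W1 (Sm Q m (p.1, p.2, 0, 0)%N) /\ W1 (Sm Q m (0, 0, p.2, p.1)%N)) /\
      (exists! p : nat * nat, inA m (p.1, 0, 0, p.2)%N /\
         W1 (Sm Q m (p.1, 0, 0, p.2)%N) /\ W1 (Sm Q m (0, p.1, p.2, 0)%N))
    &
      ~ (W1 (Sm Q m (m.-1, 0, 0, 0)%N) /\ W1 (Sm Q m (0, 0, m.-1, 0)%N)) /\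
      ~ (W1 (Sm Q m (0, m.-1, 0, 0)%N) /\ W1 (Sm Q m (0, 0, 0, m.-1)%N))].

(* Wlev n = W_{n+1}: Wlev 0 = W_1, W_{n+1} = {P_W(W') | W' in W_1, W in W_n} *)
Fixpoint Wlev (R : realType) (Q : quad R) (W1 : set (quad R)) (n : nat)
  : set (quad R) :=
  match n with
  | 0 => W1
  | n'.+1 => [set V | exists W W', [/\ Wlev Q W1 n' W, W1 W' & V = Pquad Q W W']]
  end.

(* L_{n+1} = union of the closed regions of the elements of W_{n+1} *)
Definition Llev (R : realType) (Q : quad R) (W1 : set (quad R)) (n : nat)
  : set (R * R) :=
  \bigcup_(W in Wlev Q W1 n) region W.

Definition Linf (R : realType) (Q : quad R) (W1 : set (quad R)) : set (R * R) :=
  \bigcap_(n in [set: nat]) Llev Q W1 n.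

(* Continuum theory (for subsets of R^2 with the subspace topology;     *)
(* the Hausdorff property is inherited from R^2)                        *)

Definition continuum (R : realType) (X : set (R * R)) : Prop :=
  [/\ X !=set0, compact X & connected X].

(* every point has a neighbourhood basis (in the subspace X) of connected
   open sets: relatively open sets are exactly O `&` X with O open *)
Definition locally_connected_set (R : realType) (X : set (R * R)) : Prop :=
  forall x U, X x -> nbhs x U ->
    exists O : set (R * R),
      [/\ open O, O x, O `&` X `<=` U & connected (O `&` X)].

Definition unit_circle (R : realType) : set (R * R) :=
  [set z | z.1 ^+ 2 + z.2 ^+ 2 = 1].

(* C is a simple closed curve: a homeomorphic image of the circle, i.e. the
   image of a continuous injective map on the (compact) circle into the
   Hausdorff plane *)
Definition simple_closed_curve (R : realType) (C : set (R * R)) : Prop :=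
  exists f : R * R -> R * R,
    [/\ {within @unit_circle R, continuous f},
        (forall a b, @unit_circle R a -> @unit_circle R b -> f a = f b -> a = b)
      & C = f @` @unit_circle R].

Definition dendrite (R : realType) (X : set (R * R)) : Prop :=
  [/\ continuum X, locally_connected_set X &
      ~ exists C, C `<=` X /\ simple_closed_curve C].

(* Main.v *)
Require Import Defs.
From mathcomp Require Import all_boot all_order all_algebra.
From mathcomp Require Import all_classical all_reals all_analysis.
From mathcomp Require Import ring lra zify.
From Stdlib Require List.
Set Implicit Arguments.
Unset Strict Implicit.
Unset Printing Implicit Defensive.
Import Order.TTheory GRing.Theory Num.Theory.
Import numFieldNormedType.Exports.
Local Open Scope ring_scope.
Local Open Scope classical_set_scope.

(** The map [chart], affine on both triangles of the unit square cut by its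
    diagonal, is continuous and injective, carries the squares of the [m] by [m]
    grid to the [S_m], and conjugates every [P_W] to a homothety; hence the quadrilateral
    fractal is the image of the classical labyrinth fractal [K] of the unit
    square, the union of the pieces [f_d K] over the digits [d] of the pattern.

    Two pieces share at most one point, and they share one exactly when their
    squares have a common side. Indeed a common point of two horizontal
    neighbours has two base-[m] expansions, one with digits in the last column
    and one with digits in the first; the exit property forces all digits to be
    the exit row, while a carry, or a contact across a vertex, would need pattern
    squares at two opposite corners.

    As the pattern is connected, [K] is chainable at all scales [m^-n], hence
    connected, and the pieces containing a point form small connected
    neighbourhoods of it. As the pattern has no cycle, any set of pieces has a
    leaf, which meets the others in at most one point; a circle is not
    disconnected by a point, so a simple closed curve in [K] lies in one piece,
    and, iterating, in pieces of arbitrarily small diameter. *)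

(** * Topology of the plane *)


Section PlaneTopology.
Variable R : realType.
Implicit Types (X A B C : set (R * R)) (x y z : R * R) (e : R).

Definition dist_le e x y := `|x.1 - y.1| <= e /\ `|x.2 - y.2| <= e.

Lemma dist_le_eq (x y : R * R) :
  (forall e, 0 < e -> dist_le e x y) -> x = y.
Proof.
move=> h; case: x y h => [x1 x2] [y1 y2] h.
suff H : forall a b : R, (forall e, 0 < e -> `|a - b| <= e) -> a = b.
  by congr pair; apply: H => e /h [].
move=> a b ab; apply/eqP; rewrite -subr_eq0 -normr_le0; apply/ler_addgt0Pl => e e0.
by rewrite addr0; exact: ab.
Qed.

Lemma nbhs_dist_leP x (U : set (R * R)) :
  nbhs x U <-> exists2 e, 0 < e & forall y, dist_le e x y -> U y.
Proof.
split=> [/nbhs_ballP[e /= e0 eU]|[e e0 eU]].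
  exists (e / 2); first by rewrite divr_gt0.
  move=> y [h1 h2]; apply: eU; split; rewrite -ball_normE /ball_ /=;
    apply: le_lt_trans; [exact: h1| |exact: h2|]; rewrite gtr_pMr //; lra.
apply/nbhs_ballP; exists e => //= y [h1 h2]; apply: eU; split; apply: ltW.
  by move: h1; rewrite -ball_normE.
by move: h2; rewrite -ball_normE.
Qed.

Lemma pair_continuous (T : topologicalType) (f g : T -> R) :
  continuous f -> continuous g -> continuous (fun t => (f t, g t) : R * R).
Proof. by move=> cf cg t; exact: (cvg_pair (cf t) (cg t)). Qed.

Lemma fst_cont : continuous (fun z : R * R => z.1).
Proof. by move=> z; exact: cvg_fst. Qed.

Lemma snd_cont : continuous (fun z : R * R => z.2).
Proof. by move=> z; exact: cvg_snd. Qed.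

Lemma plane_hausdorff : hausdorff_space (R * R)%type.
Proof. exact: norm_hausdorff. Qed.

(* Impredicative form of: any two points of [X] are joined by a chain of points
   of [X] with steps at most [e]. *)
Definition chainable e X := forall P : set (R * R),
  (forall x y, X x -> X y -> dist_le e x y -> P x -> P y) ->
  forall x y, X x -> X y -> P x -> P y.

(** A nonempty relatively clopen part [B] of [X] is compact and lies in the open set [U], so [U]
    contains a uniform neighbourhood of [B]; chains with shorter steps cannot leave [B]. *)
Lemma chainable_connected X : compact X ->
  (forall e, 0 < e -> exists2 e', e' <= e & chainable e' X) -> connected X.
Proof.
move=> cX chX B [b Bb] [U oU BU] [C cC BC].
have XB : X b by move: Bb; rewrite BU => -[].
have cB : compact B by rewrite BC; exact: compact_closedI.
have [e e0 eU] : exists2 e, 0 < e & forall x y, B x -> dist_le e x y -> U y.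
  have /compact_near_coveringP := cB.
  move=> /(_ R (0^'+) (fun e x => forall y, dist_le e x y -> U y) _) [].
    move=> x Bx; have Ux : U x by move: Bx; rewrite BU => -[].
    have /nbhs_dist_leP[e e0 eU] : nbhs x U by exact: open_nbhs_nbhs.
    exists ([set x' | dist_le (e / 2) x x'], [set i | i < e / 2]).
      split => /=.
        by apply/nbhs_dist_leP; exists (e / 2); first exact: divr_gt0.
      exact: (nbhs_right_lt (divr_gt0 e0 (ltr0Sn _ 1))).
    move=> [x' i] /= [[h1 h2] ie] y [k1 k2]; apply: eU; split.
      rewrite -(subrKA x'.1); apply: (le_trans (ler_normD _ _)).
      by move: h1 k1; lra.
    rewrite -(subrKA x'.2); apply: (le_trans (ler_normD _ _)).
    by move: h2 k2; lra.
  move=> d /= d0 dP; exists (d / 2); first by rewrite divr_gt0.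
  have d2 : 0 < d / 2 by exact: divr_gt0.
  move=> x y Bx xy; apply: (dP (d / 2) _ d2 x Bx y xy) => /=.
  rewrite sub0r normrN gtr0_norm //; lra.
have [e' e'e che] := chX _ e0.
apply/seteqP; split; first by rewrite BU => z [].
move=> z Xz; apply: (che B _ b z XB Xz Bb) => x y Xx Xy [xy1 xy2] Bx.
by rewrite BU; split=> //; apply: (eU x) => //; split;
  [exact: le_trans xy1 _|exact: le_trans xy2 _].
Qed.

(** Connectedness im kleinen at every point is enough: it makes the components of relatively open
    sets relatively open. *)
Lemma locally_connected_cik X :
  (forall x (U : set (R * R)), X x -> nbhs x U -> exists N : set (R * R),
    [/\ connected N, N x, N `<=` X `&` U & \forall y \near x, X y -> N y]) ->
  locally_connected_set X.
Proof.
move=> cik x U Xx xU.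
pose V := U° `&` X; pose C := connected_component V x.
have Vx : V x by split=> //.
pose O := [set y | \forall z \near y, X z -> C z]°; exists O.
(* The connected neighbourhood [N] of [y] and the component [C] share [y], so maximality of [C]
   absorbs [N]. *)
have key y : C y -> \forall z \near y, X z -> C z.
  move=> Cy; have [Uy Xy] : V y by exact: connected_component_sub Cy.
  have [N [cN Ny NXU nN]] := cik y U° Xy (open_nbhs_nbhs (conj (open_interior U) Uy)).
  apply: filterS nN => z /[apply] Nz.
  suff : N `|` C `<=` C by apply; left.
  apply: connected_component_max; first by right; exact: connected_component_refl.
    move=> w [/NXU[]//|]; exact: connected_component_sub.
  by apply: connectedU; [exists y|exact: cN|exact: component_connected].
have OX : O `&` X = C.
  apply/seteqP; split=> y.
    by move=> [/interior_subset/= h Xy]; exact: (nbhs_singleton h).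
  move=> Cy; split; last by case: (connected_component_sub Cy).
  have /nbhs_interior := key y Cy; apply: filterS => z.
  by move=> /= h; exact: h.
rewrite OX; split.
- exact: open_interior.
- have [Ox _] : (O `&` X) x by rewrite OX; exact: connected_component_refl.
  exact: Ox.
- by move=> y Cy; case: (connected_component_sub Cy) => /interior_subset.
- exact: component_connected.
Qed.

(** By compactness [f] is an embedding: the trace of an open [V] on [X] goes to the complement, in
    the image, of the compact image of the part of [X] outside [V]. *)
Lemma locally_connected_image X (f : R * R -> R * R) :
  compact X -> continuous f -> injective f ->
  locally_connected_set X -> locally_connected_set (f @` X).
Proof.
move=> cX cf injf lcX _ U [x Xx <-] fxU.
have [V [oV Vx VU cV]] := lcX x (f @^-1` U) Xx (cf x _ fxU).
have fV : ~` (f @` (X `\` V)) `&` f @` X = f @` (V `&` X).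
  apply/seteqP; split=> [y [h [z Xz zy]]|_ [z [Vz Xz] <-]].
    rewrite -zy in h *; exists z => //; split=> //; apply: contrapT => nV.
    by apply: h; exists z.
  split; last by exists z.
  by case=> w [_ nV] /injf wz; apply: nV; rewrite wz.
exists (~` (f @` (X `\` V))); split.
- rewrite openC; apply: compact_closed; first exact: plane_hausdorff.
  apply: continuous_compact; first exact: continuous_subspaceT.
  by rewrite setDE; apply: compact_closedI => //; exact: open_closedC.
- by move=> [z [_ nV] /injf zx]; apply: nV; rewrite zx.
- by rewrite fV => _ [z /VU Uz <-].
- rewrite fV; apply: connected_continuous_connected => //.
  exact: continuous_subspaceT.
Qed.

End PlaneTopology.


(** * The circle and simple closed curves *)

Section Circle.
Variable R : realType.
Implicit Types (A B C : set (R * R)) (a : R * R).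

(* The stereographic parametrisation by the line, rotated so that it misses
   exactly [a]. *)
Lemma circle_minus_point_connected a :
  unit_circle a -> connected (@unit_circle R `\ a).
Proof.
case: a => a1 a2; rewrite /unit_circle /= => ha.
pose c (t : R) := (t ^+ 2 - 1) / (t ^+ 2 + 1).
pose s (t : R) := (2 * t) / (t ^+ 2 + 1).
have nz (t : R) : t ^+ 2 + 1 != 0 by rewrite gt_eqF // ltr_wpDl // sqr_ge0.
have cs t : c t ^+ 2 + s t ^+ 2 = 1 by rewrite /c /s; field.
have c1 t : c t <> 1.
  by move=> /(congr1 (fun u => u * (t ^+ 2 + 1))); rewrite /c mulfVK // => h; lra.
have sqc : continuous (fun t : R => t ^+ 2).
  by move=> t; exact: exprn_continuous.
have ivc : continuous (fun t : R => (t ^+ 2 + 1)^-1).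
  move=> t; apply: cvgV; first exact: nz.
  by apply: cvgD; [exact: sqc|exact: cvg_cst].
have cc : continuous c.
  move=> t; apply: cvgM; last exact: ivc.
  by apply: cvgB; [exact: sqc|exact: cvg_cst].
have sc : continuous s.
  move=> t; apply: cvgM; last exact: ivc.
  by apply: cvgM; [exact: cvg_cst|exact: cvg_id].
pose g t := (a1 * c t - a2 * s t, a1 * s t + a2 * c t).
have cg : continuous g.
  apply: pair_continuous => t.
    by apply: cvgB; apply: cvgM; [exact: cvg_cst|exact: cc|exact: cvg_cst|exact: sc].
  by apply: cvgD; apply: cvgM; [exact: cvg_cst|exact: sc|exact: cvg_cst|exact: cc].
suff -> : [set z : R * R | z.1 ^+ 2 + z.2 ^+ 2 = 1] `\ (a1, a2) = g @` setT.
  apply: connected_continuous_connected; last exact: continuous_subspaceT.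
  by apply/connected_intervalP.
apply/seteqP; split=> [[z1 z2] /= [hz za]|_ [t _ <-] /=].
  (* [(k, l)] is [(z1, z2)] in the rotated frame where [a] becomes (1, 0); its stereographic
     parameter is [l / (1 - k)]. *)
  pose k := a1 * z1 + a2 * z2; pose l := a1 * z2 - a2 * z1.
  have kl : k ^+ 2 + l ^+ 2 = 1.
    transitivity ((a1 ^+ 2 + a2 ^+ 2) * (z1 ^+ 2 + z2 ^+ 2)).
      by rewrite /k /l; ring.
    by rewrite ha hz mulr1.
  have e1 : a1 * k - a2 * l = z1.
    transitivity ((a1 ^+ 2 + a2 ^+ 2) * z1); first by rewrite /k /l; ring.
    by rewrite ha mul1r.
  have e2 : a1 * l + a2 * k = z2.
    transitivity ((a1 ^+ 2 + a2 ^+ 2) * z2); first by rewrite /k /l; ring.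
    by rewrite ha mul1r.
  have k1 : 1 - k != 0.
    apply/eqP => h; have k1 : k = 1 by lra.
    have l0 : l = 0.
      by apply/eqP; rewrite -sqrf_eq0; apply/eqP; move: kl; rewrite k1; lra.
    by apply: za; rewrite -e1 -e2 k1 l0 !mulr0 !mulr1 subr0 add0r.
  have d : (l / (1 - k)) ^+ 2 + 1 = 2 / (1 - k).
    have -> : (l / (1 - k)) ^+ 2 + 1 = (k ^+ 2 + l ^+ 2 + 1 - 2 * k) / (1 - k) ^+ 2.
      by field.
    by rewrite kl; field.
  exists (l / (1 - k)) => //; rewrite /g /c /s d.
  have -> : (l / (1 - k)) ^+ 2 - 1 = 2 / (1 - k) - 2 by rewrite -d; ring.
  congr pair; [rewrite -[RHS]e1|rewrite -[RHS]e2]; field;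
    by rewrite k1.
split.
  transitivity ((a1 ^+ 2 + a2 ^+ 2) * (c t ^+ 2 + s t ^+ 2)); first by ring.
  by rewrite ha cs mulr1.
case=> e1 e2; apply: (c1 t).
transitivity ((a1 ^+ 2 + a2 ^+ 2) * c t); first by rewrite ha mul1r.
transitivity (a1 * (a1 * c t - a2 * s t) + a2 * (a1 * s t + a2 * c t)).
  by ring.
by rewrite e1 e2 -ha; ring.
Qed.

Lemma circle_connected : connected (@unit_circle R).
Proof.
have h1 : unit_circle ((1, 0) : R * R) by rewrite /unit_circle /=; ring.
have h2 : unit_circle ((-1, 0) : R * R) by rewrite /unit_circle /=; ring.
have h3 : unit_circle ((0, 1) : R * R) by rewrite /unit_circle /=; ring.
have -> : @unit_circle R = @unit_circle R `\ (1, 0) `|` @unit_circle R `\ (-1, 0).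
  apply/seteqP; split=> [z hz|z [[]|[]]//].
  have [->|z1] := pselect (z = (1, 0)); last by left.
  by right; split=> // -[] h; lra.
apply: connectedU; [|exact: circle_minus_point_connected..].
by exists (0, 1); split; split=> // -[] h; lra.
Qed.

(** If [A] and [B] meet in [p] only, they are separated away from [p], while the circle stays
    connected once the point over [p] is removed; so the curve cannot pass from one set to the
    other. *)
Lemma simple_closed_curve_sub C A B :
  simple_closed_curve C -> closed A -> closed B -> C `<=` A `|` B ->
  (forall x y, A x -> B x -> A y -> B y -> x = y) ->
  C `<=` A \/ C `<=` B.
Proof.
move=> [f [cf injf ->]] cA cB CAB one.
have [[p [Ap Bp]]|nAB] := pselect (exists p, A p /\ B p); last first.
  apply: (connected_subset _ CAB).
    rewrite /separated -!(closure_id _).1 //.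
    by split; rewrite -subset0 => x [Ax Bx]; apply: nAB; exists x.
  exact: connected_continuous_connected circle_connected cf.
have AB : separated (A `\ p) (B `\ p).
  split; rewrite -subset0 => x.
    move=> [/(closureS (@subDsetl _ A [set p]))]; rewrite -(closure_id _).1 //.
    by move=> Ax [Bx]; apply; exact: one.
  move=> [[Ax xp]] /(closureS (@subDsetl _ B [set p])).
  by rewrite -(closure_id _).1 // => Bx; apply: xp; exact: one.
have key (D : set (R * R)) : D `<=` A `|` B -> ~ D p -> connected D ->
    D `<=` A \/ D `<=` B.
  move=> DAB Dp cD.
  have : D `<=` A `\ p `|` B `\ p.
    move=> x Dx; have xp : x <> p by move=> xp; apply: Dp; rewrite -xp.
    by case: (DAB _ Dx); [left|right].
  move=> /(connected_subset AB)/(_ cD)[h|h]; [left|right];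
    exact: subset_trans h (@subDsetl _ _ _).
have [[a Ca fap]|np] := pselect (exists2 a, unit_circle a & f a = p); last first.
  by apply: key => //; exact: connected_continuous_connected circle_connected cf.
case: (key (f @` (@unit_circle R `\ a))) => [||||h].
- by move=> _ [b [Cb _] <-]; apply: CAB; exists b.
- by move=> [b [Cb ba] fb]; apply: ba; apply: injf => //; rewrite fap.
- apply: connected_continuous_connected.
    exact: circle_minus_point_connected.
  by apply: continuous_subspaceW cf; exact: subDsetl.
- move=> h; left=> _ [b Cb <-]; have [->|ba] := pselect (b = a); first by rewrite fap.
  by apply: h; exists b.
- right=> _ [b Cb <-]; have [->|ba] := pselect (b = a); first by rewrite fap.
  by apply: h; exists b.
Qed.

Lemma simple_closed_curve_points C : simple_closed_curve C ->
  exists x y, [/\ C x, C y & x <> y].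
Proof.
move=> [f [_ injf ->]].
have h1 : unit_circle ((1, 0) : R * R) by rewrite /unit_circle /=; ring.
have h3 : unit_circle ((0, 1) : R * R) by rewrite /unit_circle /=; ring.
exists (f (1, 0)), (f (0, 1)); split; [by exists (1, 0)|by exists (0, 1)|].
by move/injf => /(_ h1 h3)[] h; lra.
Qed.

End Circle.

(** * Leaves of forests *)


Section Forest.
Variables (T : finType) (e : rel T).
Implicit Types D : {set T}.

Definition acyclic D := forall x p, (2 <= size p)%N -> uniq (x :: p) ->
  {subset x :: p <= D} -> path e x p -> ~ e (last x p) x.

(* Otherwise every simple path inside [D'] could be prolonged at its head. *)
Lemma acyclic_leaf D D' : symmetric e -> irreflexive e -> acyclic D ->
  D' \subset D -> D' != finset.set0 ->
  exists2 x, x \in D' & {in D' &, forall y z, e x y -> e x z -> y = z}.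
Proof.
move=> syme irre acD /fintype.subsetP D'D D'0; apply: contrapT => noleaf.
have two x : x \in D' -> exists y z,
    [/\ y \in D', z \in D', e x y, e x z & y != z].
  move=> D'x; apply: contrapT => h; apply: noleaf; exists x => // y z yD zD xy xz.
  by apply/eqP; apply: contrapT => /negP yz; apply: h; exists y, z.
suff long n : exists x p,
    [/\ size p = n, uniq (x :: p), {subset x :: p <= D'} & path e x p].
  (* A simple path with [#|D'|] edges has more vertices than [D'] has elements. *)
  have [x [p [sp up pD _]]] := long #|D'|.
  have := fintype.subset_leq_card (introT fintype.subsetP pD).
  by rewrite (card_uniqP up) /= sp ltnn.
elim: n => [|n [x [p [sp up pD pp]]]].
  have /set0Pn[x xD] := D'0; exists x, [::]; split=> // y.
  by rewrite inE => /eqP ->.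
have D'x : x \in D' by apply: pD; rewrite mem_head.
(* For a nonempty path, [head x p] is the vertex next to [x]; one of two distinct neighbours of [x]
   avoids it. *)
have [y [yD xy yp]] : exists y, [/\ y \in D', e x y & y != head x p].
  have [y [z [yD zD xy xz yz]]] := two x D'x.
  have [yh|yh] := eqVneq y (head x p); last by exists y.
  by exists z; rewrite -yh eq_sym.
exists y, (x :: p); split => /=; first by rewrite sp.
- rewrite -/(uniq (x :: p)) up andbT inE negb_or.
  apply/andP; split; first by apply: contraTneq xy => ->; rewrite irre.
  (* If [y] were already on the path, the stretch from [x] to [y] would close up to a cycle, with at
     least three vertices because [y] is not next to [x] on it. *)
  apply/negP => yinp; case/path.splitP: yinp up pD pp yp => p1 p2 up pD pp yp.
  have p10 : p1 != [::] by apply: contraNneq yp => ->.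
  apply: (acD x (rcons p1 y)).
  + by rewrite size_rcons ltnS lt0n size_eq0.
  + by move: up; rewrite -cat_cons cat_uniq => /andP[].
  + by move=> w wp; apply: D'D; apply: pD; rewrite -cat_cons mem_cat wp.
  + by move: pp; rewrite cat_path => /andP[].
  + by rewrite last_rcons syme.
- by move=> w; rewrite inE => /predU1P[->|/pD].
- by rewrite syme xy.
Qed.

End Forest.

(** * Base-[m] digits *)


Section Carry.
Variable R : realType.

(** This is the ambiguity of positional expansions: remainders range over the closed interval
    [0, 1], so the digits may differ by one, at the price of remainders 0 and 1. *)
Lemma carry (i j : nat) (u v : R) : 0 <= u <= 1 -> 0 <= v <= 1 ->
  i%:R + u = j%:R + v ->
  [\/ i = j /\ u = v, [/\ i = j.+1, u = 0 & v = 1] | [/\ j = i.+1, u = 1 & v = 0]].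
Proof.
move=> /andP[u0 u1] /andP[v0 v1] e.
have lt (a b : nat) : (a < b)%N -> a%:R + 1 <= b%:R :> R by rewrite natr1 ler_nat.
have S (a b : nat) : b%:R = a%:R + 1 :> R -> b = a.+1.
  by rewrite natr1 => /eqP; rewrite eqr_nat => /eqP.
case: (ltngtP i j) => [/lt|/lt|ij].
- by move=> h; apply: Or33; split; [apply: S; lra|lra|lra].
- by move=> h; apply: Or32; split; [apply: S; lra|lra|lra].
- by apply: Or31; split=> //; move: e; rewrite ij => /addrI.
Qed.

Lemma digit_top (m i : nat) (u : R) : (i < m)%N -> 0 <= u <= 1 ->
  m%:R = i%:R + u -> i = m.-1 /\ u = 1.
Proof.
move=> im u01 e; have := @carry m i 0 u _ u01.
rewrite addr0 lexx ler01 => /(_ isT e)[[mi]|[-> _ ->]//|[im1]]; lia.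
Qed.

Lemma digit_bot (i : nat) (u : R) : 0 <= u <= 1 -> 0 = i%:R + u -> i = 0%N /\ u = 0.
Proof.
move=> u01 e; have := @carry 0 i 0 u _ u01.
rewrite addr0 lexx ler01 => /(_ isT e)[[<- <-] //|[] //|[_ h _]].
by move: (@ltr01 R); rewrite -h ltxx.
Qed.

Lemma expVn_small (m : nat) (e : R) : (1 < m)%N -> 0 < e ->
  exists n, (m%:R^-1) ^+ n <= e.
Proof.
move=> m1 e0; exists (Num.bound e^-1).
have m0 : 0 < m%:R :> R by rewrite ltr0n; lia.
rewrite exprVn invf_ple ?posrE ?exprn_gt0 //.
apply: (le_trans (ltW (archi_boundP _))); first by rewrite invr_ge0 ltW.
by rewrite -natrX ler_nat ltnW // ltn_expl.
Qed.

End Carry.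

(** * Uniqueness of the exit points *)

Section UniqueExit.
Variables (R : realType) (m : nat) (P : nat -> nat -> Prop) (X : set (R * R)).
Hypothesis m1 : (1 < m)%N.
Hypothesis X01 : forall z, X z -> 0 <= z.1 <= 1 /\ 0 <= z.2 <= 1.
Hypothesis Xdigits : forall z, X z -> exists i j u,
  [/\ (i < m)%N, (j < m)%N, P i j, X u &
      m%:R * z.1 = i%:R + u.1 /\ m%:R * z.2 = j%:R + u.2].

(** A corner of the unit square lies in a single square of the grid, so its first digits are
    forced. *)
Lemma corner00 : X (0, 0) -> P 0 0.
Proof.
move=> /Xdigits[i [j [u [im jm Pij /X01[u1 u2] /=]]]].
by rewrite !mulr0 => -[/(digit_bot u1)[i0 _] /(digit_bot u2)[j0 _]];
  rewrite i0 j0 in Pij.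
Qed.

Lemma corner11 : X (1, 1) -> P m.-1 m.-1.
Proof.
move=> /Xdigits[i [j [u [im jm Pij /X01[u1 u2] /=]]]].
by rewrite !mulr1 => -[/(digit_top im u1)[i0 _] /(digit_top jm u2)[j0 _]];
  rewrite i0 j0 in Pij.
Qed.

Lemma corner01 : X (0, 1) -> P 0 m.-1.
Proof.
move=> /Xdigits[i [j [u [im jm Pij /X01[u1 u2] /=]]]].
by rewrite mulr0 mulr1 => -[/(digit_bot u1)[i0 _] /(digit_top jm u2)[j0 _]];
  rewrite i0 j0 in Pij.
Qed.

Lemma corner10 : X (1, 0) -> P m.-1 0.
Proof.
move=> /Xdigits[i [j [u [im jm Pij /X01[u1 u2] /=]]]].
by rewrite mulr0 mulr1 => -[/(digit_top im u1)[i0 _] /(digit_bot u2)[j0 _]];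
  rewrite i0 j0 in Pij.
Qed.

(* The two expansions of [y] have the common digit [r] at every place: a carry
   between them would put opposite corners in [X]. *)
Lemma exit_unique (r : nat) :
  ~ (P 0 0 /\ P m.-1 m.-1) -> ~ (P m.-1 0 /\ P 0 m.-1) ->
  (forall j, P m.-1 j -> P 0 j -> j = r) ->
  forall y, X (1, y) -> X (0, y) -> y = r%:R / (m%:R - 1).
Proof.
move=> c1 c2 rP; have m0 : 1 < m%:R :> R by rewrite ltr1n.
(* The number all of whose base-[m] digits are [r], that is, the fixed point of y -> (r + y) / m. *)
set p := r%:R / (m%:R - 1).
have pE : m%:R * p = r%:R + p by rewrite /p; field; lra.
have r0 : 0 <= p by rewrite divr_ge0 // subr_ge0 ltW.
(* Each common digit [r] gains a factor [m] in the distance to [p]; the constant [1 + p] bounds that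
   distance at the start, as [y] lies in [0, 1]. *)
suff small n : forall y, X (1, y) -> X (0, y) ->
    `|y - p| <= m%:R^-1 ^+ n * (1 + p).
  move=> y Xy1 Xy0; apply/eqP; rewrite -subr_eq0 -normr_le0; apply/ler_addgt0Pl => e e0.
  have [n ne] : exists n, m%:R^-1 ^+ n <= e / (1 + p).
    by apply: expVn_small => //; apply: divr_gt0 => //; lra.
  rewrite addr0; apply: (le_trans (small n _ Xy1 Xy0)).
  by rewrite -ler_pdivlMr //; lra.
elim: n => [|n IH] y.
  move=> /X01[_ /= /andP[y0 y1]] _; rewrite expr0 mul1r ler_norml.
  by apply/andP; split; lra.
move=> /Xdigits[i [j [u [im jm Pij Xu /= []]]]].
rewrite mulr1 => /(digit_top im (X01 Xu).1)[ie u1] mj.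
move=> /Xdigits[i' [j' [u' [im' jm' Pij' Xu' /= []]]]].
rewrite mulr0 => /(digit_bot (X01 Xu').1)[ie' u1'] mj'.
have ue : u = (1, u.2) by rewrite -u1 -surjective_pairing.
have ue' : u' = (0, u'.2) by rewrite -u1' -surjective_pairing.
rewrite mj in mj'; subst i i'.
case: (carry (X01 Xu).2 (X01 Xu').2 mj') => [[jj uu]|[jj uu uu']|[jj uu uu']].
- subst j'; have jr := rP _ Pij Pij'; subst j.
  have := IH u.2; rewrite -ue uu -ue' => /(_ Xu Xu') {}IH.
  rewrite exprS -mulrA ler_pdivlMl; last by lra.
  have e : u'.2 - p = m%:R * (y - p) by rewrite mulrBr mj pE uu; ring.
  by move: IH; rewrite e normrM ger0_norm //; lra.
- case: c2; split; [apply: corner10|apply: corner01].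
    by rewrite ue uu in Xu.
  by rewrite ue' uu' in Xu'.
- case: c1; split; [apply: corner00|apply: corner11].
    by rewrite ue' uu' in Xu'.
  by rewrite ue uu in Xu.
Qed.

End UniqueExit.

(** * Fractals of patterns in the unit square *)


Section SquareFractal.
Variables (R : realType) (m : nat).
Local Notation cell := ('I_m * 'I_m)%type.
Implicit Types (d : cell) (z u v : R * R) (X : set (R * R)).

Definition unit_square : set (R * R) := [set z | 0 <= z.1 <= 1 /\ 0 <= z.2 <= 1].

Definition shrink d z : R * R :=
  ((d.1%:R + z.1) / m%:R, (d.2%:R + z.2) / m%:R).

Definition expand d z : R * R := (m%:R * z.1 - d.1%:R, m%:R * z.2 - d.2%:R).

Definition side_adjacent : rel cell := fun d d' =>
  ((d.1 == d'.1 :> nat) && ((d.2 == d'.2.+1 :> nat) || (d'.2 == d.2.+1 :> nat)))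
  || ((d.2 == d'.2 :> nat) && ((d.1 == d'.1.+1 :> nat) || (d'.1 == d.1.+1 :> nat))).

Definition refine (D : {set cell}) X : set (R * R) :=
  [set z | exists2 d, d \in D & exists2 u, X u & z = shrink d u].

(** The attractor of the contractions [shrink d] with [d \in D]. *)
Definition square_fractal (D : {set cell}) : set (R * R) :=
  \bigcap_n iter n (refine D) unit_square.

Hypothesis m1 : (1 < m)%N.

Let m1R : 1 < m%:R :> R. Proof. by rewrite ltr1n. Qed.
Let m0R : m%:R != 0 :> R. Proof. by rewrite pnatr_eq0; lia. Qed.

Lemma shrinkK d : cancel (shrink d) (expand d).
Proof. by move=> [x y]; rewrite /expand /=; congr pair; field. Qed.

Lemma expandK d : cancel (expand d) (shrink d).
Proof. by move=> [x y]; rewrite /shrink /=; congr pair; field. Qed.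

Lemma shrink_inj d : injective (shrink d).
Proof. exact: can_inj (shrinkK d). Qed.

Lemma shrink_continuous d : continuous (shrink d).
Proof.
apply: pair_continuous => z; apply: cvgM; try exact: cvg_cst.
  by apply: cvgD; [exact: cvg_cst|exact: fst_cont].
by apply: cvgD; [exact: cvg_cst|exact: snd_cont].
Qed.

Lemma expand_continuous d : continuous (expand d).
Proof.
apply: pair_continuous => z; apply: cvgB; try exact: cvg_cst.
  by apply: cvgM; [exact: cvg_cst|exact: fst_cont].
by apply: cvgM; [exact: cvg_cst|exact: snd_cont].
Qed.

Lemma dist_le_shrink d e u v : dist_le e u v -> dist_le (e / m%:R) (shrink d u) (shrink d v).
Proof.
have h (a b c : R) : `|b - c| <= e -> `|(a + b) / m%:R - (a + c) / m%:R| <= e / m%:R.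
  move=> bc; have -> : (a + b) / m%:R - (a + c) / m%:R = (b - c) / m%:R by ring.
  rewrite normrM (@ger0_norm _ (m%:R^-1)) ?invr_ge0 //.
  by rewrite ler_wpM2r ?invr_ge0.
by move=> [h1 h2]; split; exact: h.
Qed.

Lemma shrink_unit_square d u : unit_square u -> unit_square (shrink d u).
Proof.
have h (i : 'I_m) (a : R) : 0 <= a <= 1 -> 0 <= (i%:R + a) / m%:R <= 1.
  move=> /andP[a0 a1]; have im : i%:R + 1 <= m%:R :> R by rewrite natr1 ler_nat.
  have i0 : 0 <= i%:R :> R by [].
  rewrite divr_ge0 ?addr_ge0 //= ler_pdivrMr ?mul1r; lra.
by move=> [u1 u2]; split; exact: h.
Qed.

Lemma unit_square_compact : compact unit_square.
Proof.
have -> : unit_square = `[0, 1]%classic `*` `[0, 1]%classic.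
  by apply/seteqP; split=> z; rewrite /unit_square /= !in_itv.
by apply: compact_setX; exact: segment_compact.
Qed.

Variable D : {set cell}.
Local Notation K := (square_fractal D).

Lemma refine_mono X Y : X `<=` Y -> refine D X `<=` refine D Y.
Proof. by move=> XY z [d dD [u /XY Yu ->]]; exists d => //; exists u. Qed.

Lemma iter_refine_decr n k : (k <= n)%N ->
  iter n (refine D) unit_square `<=` iter k (refine D) unit_square.
Proof.
elim: n k => [|n IH] [|k] //= kn; first by [].
  apply: (subset_trans _ (IH 0%N (leq0n _))).
  elim: n {IH kn} => [|n IH] /=; last exact: refine_mono.
  by move=> z [d dD [u uS ->]]; exact: shrink_unit_square.
by apply: refine_mono; exact: IH.
Qed.

Lemma refine_closed X : closed X -> closed (refine D X).
Proof.
move=> cX.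
have -> : refine D X = \bigcup_(d in [set` D]) (expand d @^-1` X).
  apply/seteqP; split=> [z [d dD [u uX ->]]|z [d dD zX]].
    by exists d => //=; rewrite shrinkK.
  by exists d => //; exists (expand d z) => //; rewrite expandK.
apply: closed_bigcup => [|d _]; first exact: finite_finpred.
by move/continuous_closedP : (@expand_continuous d); exact.
Qed.

Lemma fractal_unit_square : K `<=` unit_square.
Proof. by move=> z /(_ 0%N I). Qed.

Lemma fractal_compact : compact K.
Proof.
apply: subclosed_compact unit_square_compact fractal_unit_square.
apply: closed_bigI => n _; elim: n => [|n IH] /=; last exact: refine_closed.
apply: compact_closed unit_square_compact; exact: plane_hausdorff.
Qed.

Lemma fractal_shrink d u : d \in D -> K u -> K (shrink d u).
Proof.
move=> dD Ku [|n] _ /=; last by exists d => //; exists u => //; exact: Ku.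
by apply: shrink_unit_square; exact: fractal_unit_square.
Qed.

(** This half of self-similarity rests on the finiteness of the digit set: if every digit failed for
    [z], each at its own level [N d], all would fail at the largest of these levels. *)
Lemma fractal_digit z : K z -> exists d u, [/\ d \in D, K u & z = shrink d u].
Proof.
move=> Kz; apply: contrapT => nz.
have /choice[N NP] : forall d, exists n,
    d \in D -> ~ iter n (refine D) unit_square (expand d z).
  move=> d; apply: contrapT => h; apply: nz; exists d, (expand d z).
  rewrite expandK; split=> //; first by apply: contrapT => dD; apply: h; exists 0%N.
  by move=> n _; apply: contrapT => nn; apply: h; exists n.
have [d dD [u uN zu]] := Kz (\max_(d : cell) N d).+1 I.
apply: (NP d dD); rewrite zu shrinkK.
by apply: iter_refine_decr uN; exact: leq_bigmax.
Qed.

Lemma fractal_fixpoint d z : d \in D -> unit_square z -> shrink d z = z -> K z.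
Proof.
move=> dD zS zz n _; elim: n => //= n IH.
by exists d => //; exists z.
Qed.

(** Chainability and the existence of small connected neighbourhoods both pass from scale [e] to
    [e / m], one level deeper in the fractal; this turns that step into arbitrarily small scales. *)
Lemma all_scales (T : R -> Prop) : T 1 -> (forall e, T e -> T (e / m%:R)) ->
  forall e, 0 < e -> exists2 e', e' <= e & T e'.
Proof.
move=> T1 Tm e e0; have [n ne] := expVn_small m1 e0.
exists (m%:R^-1 ^+ n) => //; elim: n {ne} => [|n IH]; first by rewrite expr0.
by rewrite exprSr; exact: Tm.
Qed.

Lemma dist_le1_unit_square x y : unit_square x -> unit_square y -> dist_le 1 x y.
Proof.
have h (a b : R) : 0 <= a <= 1 -> 0 <= b <= 1 -> `|a - b| <= 1.
  by move=> /andP[? ?] /andP[? ?]; rewrite ler_norml; apply/andP; split; lra.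
by move=> [x1 x2] [y1 y2]; split; exact: h.
Qed.

Lemma fractal_locally_connected : connected K -> locally_connected_set K.
Proof.
move=> cK.
(* At scale 1 the whole of [K] serves; at scale [e / m], neighbourhoods of scale [e] are transported
   into the pieces through [x] and united. *)
pose T e := forall x, K x -> exists N : set (R * R),
  [/\ connected N, N x, N `<=` K, (forall y, N y -> dist_le e x y)
    & \forall y \near x, K y -> N y].
suff scales : forall e, 0 < e -> exists2 e', e' <= e & T e'.
  apply: locally_connected_cik => x U Kx /nbhs_dist_leP[e e0 eU].
  have [e' e'e /(_ x Kx)[N [cN Nx NK Ne nN]]] := scales e e0.
  exists N; split=> // y Ny; split; first exact: NK.
  by apply: eU; have [h1 h2] := Ne y Ny; split;
    [exact: le_trans h1 _|exact: le_trans h2 _].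
apply: all_scales => [x Kx|e Te x Kx].
  exists K; split=> // [y Ky|]; last by near=> y.
  by apply: dist_le1_unit_square; exact: fractal_unit_square.
have /choice[N NP] : forall d, exists N : set (R * R),
    [/\ N `<=` K, (N !=set0 -> connected N /\ N x), (forall y, N y -> dist_le (e / m%:R) x y)
      & \forall y \near x, d \in D -> (shrink d @` K) y -> N y].
  (* A piece that misses [x] is closed, hence is missed by a neighbourhood of [x], and the empty set
     serves for it. *)
  move=> d; have [[dD Kd]|nd] := pselect (d \in D /\ (shrink d @` K) x); last first.
    exists set0; split=> //; first by case.
    have [dD|nD] := boolP (d \in D); last by near=> y.
    have : nbhs x (~` (shrink d @` K)).
      apply: open_nbhs_nbhs; split; last by move=> h; apply: nd.
      rewrite openC; apply: compact_closed; first exact: plane_hausdorff.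
      apply: continuous_compact fractal_compact.
      apply: continuous_subspaceT; exact: shrink_continuous.
    by apply: filterS => y ny _ /ny.
  case: Kd => u Ku ux; have [N [cN Nu NK Ne nN]] := Te u Ku.
  exists (shrink d @` N); split.
  - by move=> _ [v /NK Kv <-]; exact: fractal_shrink.
  - move=> _; split; last by exists u.
    apply: connected_continuous_connected => //.
    apply: continuous_subspaceT; exact: shrink_continuous.
  - by move=> _ [v /Ne uv <-]; rewrite -ux; exact: dist_le_shrink.
  - have : \forall y \near x, K (expand d y) -> N (expand d y).
      have nN' : nbhs (expand d x) (fun v => K v -> N v) by rewrite -ux shrinkK.
      exact: (@expand_continuous d x _ nN').
    apply: filterS => y h _ [v Kv vy]; exists v => //.
    by move: h; rewrite -vy shrinkK; exact.
have [d0 [u0 [d0D Ku0 xu0]]] := fractal_digit Kx.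
have Nx0 : N d0 x.
  have [_ _ _ /nbhs_singleton] := NP d0; apply=> //; by exists u0.
(* The united sets all contain [x], so the union is connected; a nonempty [N d] always contains [x],
   so nothing is lost. *)
exists (\bigcup_(d in [set d | N d x]) N d); split.
- apply: bigcup_connected; first by exists x.
  by move=> d Ndx; have [_ h _ _] := NP d; case: h => //; exists x.
- by exists d0.
- by move=> y [d _]; have [h _ _ _] := NP d; exact: h.
- by move=> y [d _]; have [_ _ h _] := NP d; exact: h.
- have : \forall y \near x, forall d, d \in D -> (shrink d @` K) y -> N d y.
    apply: (@filter_forall _ _
      (fun d y => d \in D -> (shrink d @` K) y -> N d y) (nbhs x) _) => d.
    by have [_ _ _] := NP d.
  apply: filterS => y h /fractal_digit[d [u [dD Ku yu]]].
  have Ndy : N d y by apply: h => //; exists u.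
  by exists d => //=; have [_ [] //] := NP d; exists y.
Unshelve. all: end_near. Qed.

End SquareFractal.


(** * Labyrinth patterns: contacts of pieces, connectedness, absence of curves *)

Section Labyrinth.
Variables (R : realType) (m : nat).
Local Notation cell := ('I_m * 'I_m)%type.
Variables (D : {set cell}) (r c : nat).
Local Notation K := (@square_fractal R m D).

(** Cells are addressed by plain numbers, column first, so that [0] and [m.-1] carry no proof of
    being below [m]. *)
Definition cell_in i j := exists2 d : cell, d \in D & d.1 = i :> nat /\ d.2 = j :> nat.

Hypothesis m1 : (1 < m)%N.
Hypothesis diag : ~ (cell_in 0 0 /\ cell_in m.-1 m.-1).
Hypothesis antidiag : ~ (cell_in m.-1 0 /\ cell_in 0 m.-1).
Hypothesis row_left : cell_in 0 r.
Hypothesis row_right : cell_in m.-1 r.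
Hypothesis row_uniq : forall j, cell_in m.-1 j -> cell_in 0 j -> j = r.
Hypothesis col_bottom : cell_in c 0.
Hypothesis col_top : cell_in c m.-1.
Hypothesis col_uniq : forall i, cell_in i m.-1 -> cell_in i 0 -> i = c.
Hypothesis pathD : forall d d', d \in D -> d' \in D -> exists p,
  [/\ path (@side_adjacent m) d p, {subset p <= D} & last d p = d'].
Hypothesis acyclicD : acyclic (@side_adjacent m) D.

Let m1R : 1 < m%:R :> R. Proof. by rewrite ltr1n. Qed.
Let m0R : m%:R != 0 :> R. Proof. by rewrite pnatr_eq0; lia. Qed.
Let mB1 : m%:R - 1 != 0 :> R. Proof. by rewrite subr_eq0 gt_eqF. Qed.

Let row_exit : R := r%:R / (m%:R - 1).
Let col_exit : R := c%:R / (m%:R - 1).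

Lemma fractal_digits z : K z -> exists i j u,
  [/\ (i < m)%N, (j < m)%N, cell_in i j, K u &
      m%:R * z.1 = i%:R + u.1 /\ m%:R * z.2 = j%:R + u.2].
Proof.
move=> /(fractal_digit m1)[d [u [dD Ku ->]]]; exists d.1, d.2, u; split=> //.
  by exists d.
by rewrite /shrink /=; split; field.
Qed.

Lemma exit01 k : cell_in 0 k \/ cell_in k 0 -> 0 <= (k%:R / (m%:R - 1) : R) <= 1.
Proof.
move=> h; have km : (k < m)%N by case: h => -[[i j] _ /= []] => [_ <-|<- _].
have : k%:R + 1 <= m%:R :> R by rewrite natr1 ler_nat.
move=> kmR; have mB : 0 < m%:R - 1 :> R by rewrite subr_gt0.
by rewrite divr_ge0 ?(ltW mB) //= ler_pdivrMr //; lra.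
Qed.

(** Each exit is the fixed point of the contraction onto the exit square on its side. *)
Lemma exits_in_fractal :
  [/\ K (0, row_exit), K (1, row_exit), K (col_exit, 0) & K (col_exit, 1)].
Proof.
have hr := exit01 (or_introl row_left); have hc := exit01 (or_intror col_bottom).
have natm : (m.-1)%:R = m%:R - 1 :> R by rewrite -subn1 natrB //; lia.
have fix_ (d : cell) z : d \in D -> unit_square z ->
    d.1%:R + z.1 = m%:R * z.1 -> d.2%:R + z.2 = m%:R * z.2 -> K z.
  move=> dD zS e1 e2; apply: (@fractal_fixpoint R m D d) => //.
  rewrite /shrink e1 e2; case: z {zS e1 e2} => x y /=.
  by congr pair; field.
have z0 : 0 <= (0 : R) <= 1 by rewrite lexx ler01.
have o1 : 0 <= (1 : R) <= 1 by rewrite lexx ler01.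
have re : r%:R + row_exit = m%:R * row_exit by rewrite /row_exit; field.
have ce : c%:R + col_exit = m%:R * col_exit by rewrite /col_exit; field.
split.
- by case: row_left => d dD [d1 d2]; apply: (fix_ d) => //=; rewrite ?d1 ?d2 //; ring.
- by case: row_right => d dD [d1 d2]; apply: (fix_ d) => //=; rewrite ?d1 ?d2 // natm; ring.
- by case: col_bottom => d dD [d1 d2]; apply: (fix_ d) => //=; rewrite ?d1 ?d2 //; ring.
- by case: col_top => d dD [d1 d2]; apply: (fix_ d) => //=; rewrite ?d1 ?d2 // natm; ring.
Qed.

Lemma row_exit_unique y : K (1, y) -> K (0, y) -> y = row_exit.
Proof.
apply: (exit_unique m1 _ fractal_digits diag antidiag row_uniq) => z.
exact: fractal_unit_square.
Qed.

(** Transposing the plane exchanges columns and rows, so [exit_unique] applies to the transposed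
    fractal. *)
Lemma col_exit_unique x : K (x, 1) -> K (x, 0) -> x = col_exit.
Proof.
apply: (@exit_unique _ _ (fun i j => cell_in j i) [set z | K (z.2, z.1)] m1) => //=.
- by move=> z /fractal_unit_square[].
- move=> z /fractal_digits[i [j [[u1 u2] [im jm Dij Ku [e1 e2]]]]].
  by exists j, i, (u2, u1).
- by move=> [h1 h2]; apply: antidiag.
Qed.

Lemma no_opposite_corners : ~ (K (0, 0) /\ K (1, 1)) /\ ~ (K (1, 0) /\ K (0, 1)).
Proof.
have X01 z : K z -> 0 <= z.1 <= 1 /\ 0 <= z.2 <= 1 by exact: fractal_unit_square.
split=> -[h1 h2].
- apply: diag; split.
    exact: (corner00 X01 fractal_digits).
  exact: (corner11 X01 fractal_digits).
- apply: antidiag; split.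
    exact: (corner10 X01 fractal_digits).
  exact: (corner01 X01 fractal_digits).
Qed.

(** The coordinates of a common point are compared by [carry]. No carry means equal cells; one
    carry, side neighbours meeting at an exit; two carries, a contact across a vertex, which would
    put opposite corners of the unit square in [K]. *)
Lemma meeting_cases (d d' : cell) (u v : R * R) : d != d' -> K u -> K v ->
  shrink d u = shrink d' v ->
  [\/ [/\ d.2 = d'.2 :> nat, d.1 = d'.1.+1 :> nat & u = (0, row_exit)],
      [/\ d.2 = d'.2 :> nat, d'.1 = d.1.+1 :> nat & u = (1, row_exit)],
      [/\ d.1 = d'.1 :> nat, d.2 = d'.2.+1 :> nat & u = (col_exit, 0)]
    | [/\ d.1 = d'.1 :> nat, d'.2 = d.2.+1 :> nat & u = (col_exit, 1)]].
Proof.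
case: d => d1 d2; case: d' => d1' d2'; case: u => u1 u2; case: v => v1 v2 /=.
move=> dd Ku Kv; rewrite /shrink /= => -[e1 e2].
have [/= hu1 hu2] := fractal_unit_square Ku.
have [/= hv1 hv2] := fractal_unit_square Kv.
have mI : injective (fun x : R => x / m%:R) by apply: mulIf; rewrite invr_eq0.
have {e1}E1 := carry hu1 hv1 (mI _ _ e1).
have {e2}E2 := carry hu2 hv2 (mI _ _ e2).
have [nd na] := no_opposite_corners.
case: E1 => [[f1 g1]|[f1 g1 k1]|[f1 g1 k1]]; case: E2 => [[f2 g2]|[f2 g2 k2]|[f2 g2 k2]];
  subst.
- by move: dd; rewrite (val_inj f1) (val_inj f2) eqxx.
- by apply: Or43; split=> //; rewrite (@col_exit_unique v1).
- by apply: Or44; split=> //; rewrite (@col_exit_unique v1).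
- by apply: Or41; split=> //; rewrite (@row_exit_unique v2).
- by case: nd.
- by case: na.
- by apply: Or42; split=> //; rewrite (@row_exit_unique v2).
- by case: na.
- by case: nd.
Qed.

Lemma meeting_adjacent (d d' : cell) u v : d != d' -> K u -> K v ->
  shrink d u = shrink d' v -> side_adjacent d d'.
Proof.
move=> dd Ku Kv; rewrite /side_adjacent.
by move=> /(meeting_cases dd Ku Kv)[] [-> -> _]; rewrite !eqxx ?orbT.
Qed.

(** The relative position of the two cells selects one of the four cases, and each case names its
    point. *)
Lemma meeting_unique (d d' : cell) u v u' v' : d != d' -> K u -> K v -> K u' -> K v' ->
  shrink d u = shrink d' v -> shrink d u' = shrink d' v' -> u = u'.
Proof.
move=> dd Ku Kv Ku' Kv' /(meeting_cases dd Ku Kv) h /(meeting_cases dd Ku' Kv') h'.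
by case: h => -[a1 a2 ->]; case: h' => -[b1 b2 ->] //; lia.
Qed.

(** The left and right exits have the same height, and the bottom and top exits the same abscissa,
    so they coincide on the common side of two neighbours. *)
Lemma adjacent_meet (d d' : cell) : side_adjacent d d' ->
  exists u v, [/\ K u, K v & shrink d u = shrink d' v].
Proof.
have [K0 K1 K2 K3] := exits_in_fractal.
case: d => d1 d2; case: d' => d1' d2'.
move=> /orP[] /andP[/= /eqP e /orP[]/eqP f].
- exists (col_exit, 0), (col_exit, 1); split=> //.
  by rewrite /shrink /= e f addr0 natr1.
- exists (col_exit, 1), (col_exit, 0); split=> //.
  by rewrite /shrink /= e f addr0 natr1.
- exists (0, row_exit), (1, row_exit); split=> //.
  by rewrite /shrink /= e f addr0 natr1.
- exists (1, row_exit), (0, row_exit); split=> //.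
  by rewrite /shrink /= e f addr0 natr1.
Qed.

(** Inside a piece the chains of [K] are scaled down; neighbouring pieces share a point, so chains
    are concatenated along a path of cells. *)
Lemma fractal_chainable e : chainable e K -> chainable (e / m%:R) K.
Proof.
move=> chK P HP x y /(fractal_digit m1)[d [u [dD Ku ->]]].
move=> /(fractal_digit m1)[d' [u' [d'D Ku' ->]]].
have spread (b : cell) v v' : b \in D -> K v -> K v' ->
    P (shrink b v) -> P (shrink b v').
  move=> bD Kv Kv'; apply: (chK (P \o shrink b)) => // w w' Kw Kw' ww'.
  by apply: HP; [exact: fractal_shrink..|exact: dist_le_shrink].
have [p [pp pD <-]] := pathD dD d'D.
elim: p d u dD Ku pp pD => [|b p IH] d u dD Ku /=; first by move=> _ _; exact: spread.
move=> /andP[/adjacent_meet[w [w' [Kw Kw' ww']]] pp] pD Pu.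
have bD : b \in D by apply: pD; rewrite mem_head.
apply: (IH b w') => //; first by move=> a ap; apply: pD; rewrite inE ap orbT.
by rewrite -ww'; exact: (spread d u w).
Qed.

Lemma labyrinth_connected : connected K.
Proof.
apply: chainable_connected; first exact: fractal_compact.
apply: (all_scales m1 (T := fun e => chainable e K)) => [P HP x y Kx Ky|e].
  by apply: (HP x y) => //; apply: dist_le1_unit_square;
    [exact: fractal_unit_square Kx|exact: fractal_unit_square Ky].
exact: fractal_chainable.
Qed.

(* Prune leaves of the tree one after the other: the piece over a leaf meets
   the union of the other pieces in at most one point, which cannot separate
   [C]. *)
Lemma curve_in_piece (g : R * R -> R * R) C : continuous g -> injective g ->
  simple_closed_curve C -> C `<=` g @` K ->
  exists2 d, d \in D & C `<=` (g \o shrink d) @` K.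
Proof.
move=> cg injg scC CK.
have piece_closed (E : {set cell}) :
    closed (\bigcup_(d in [set` E]) ((g \o shrink d) @` K)).
  apply: closed_bigcup => [|d _]; first exact: finite_finpred.
  apply: compact_closed; first exact: plane_hausdorff.
  have cgd : continuous (g \o shrink d).
    move=> z; apply: continuous_comp; last exact: cg.
    exact: (@shrink_continuous R m d z).
  by apply: continuous_compact; [exact: continuous_subspaceT|exact: fractal_compact].
have [x0 [y0 [Cx0 _ _]]] := simple_closed_curve_points scC.
suff prune n (E : {set cell}) : (#|E| <= n)%N -> E \subset D ->
    C `<=` \bigcup_(d in [set` E]) ((g \o shrink d) @` K) ->
    exists2 d, d \in D & C `<=` (g \o shrink d) @` K.
  apply: (prune #|D| D) => // x /CK[_ /(fractal_digit m1)[d [u [dD Ku ->]]] <-].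
  by exists d => //; exists u.
elim: n E => [|n IH] E En ED CE.
  have [d /= dE _] := CE _ Cx0; move: En; rewrite leqn0 cards_eq0 => /eqP E0.
  by rewrite E0 finset.inE in dE.
have E0 : E != finset.set0.
  by apply/set0Pn; have [d /= dE _] := CE _ Cx0; exists d.
have adjC : symmetric (@side_adjacent m).
  by move=> d d'; rewrite /side_adjacent; lia.
have adjI : irreflexive (@side_adjacent m).
  by move=> d; rewrite /side_adjacent; lia.
have [l lE leaf] := acyclic_leaf adjC adjI acyclicD ED E0.
have := @simple_closed_curve_sub R C ((g \o shrink l) @` K)
  (\bigcup_(d in [set` (E :\ l)%SET]) ((g \o shrink d) @` K)) scC.
case=> [|||x y|Cl|Crest].
- have := piece_closed [set l]%SET; congr closed.
  apply/seteqP; split=> [z [d /=]|z hz]; first by rewrite finset.inE => /eqP ->.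
  by exists l => //=; rewrite finset.inE.
- exact: piece_closed.
- move=> x /CE[d /= dE hx]; have [dl|dl] := eqVneq d l; first by left; rewrite -dl.
  by right; exists d => //=; rewrite !finset.inE dl.
(* Two contact points could lie in pieces over different neighbours of [l]; the leaf property
   identifies these neighbours, and two pieces meet in at most one point. *)
- move=> [u Ku <-] [d /= dE [v Kv guv]] [u' Ku' <-] [d' /= d'E [v' Kv' guv']].
  move: dE d'E; rewrite !finset.inE => /andP[dl dE] /andP[d'l d'E].
  have e := esym (injg _ _ guv); have e' := esym (injg _ _ guv').
  rewrite eq_sym in dl; rewrite eq_sym in d'l.
  have dd' : d = d' by apply: leaf => //;
    [exact: meeting_adjacent e|exact: meeting_adjacent e'].
  rewrite -dd' in e'; congr (g (shrink l _)).
  exact: (meeting_unique dl Ku Kv Ku' Kv').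
- by exists l => //; exact: (fintype.subsetP ED).
- apply: IH Crest; last by apply: fintype.subset_trans ED; exact: subsetDl.
  by move: En; rewrite (cardsD1 l) lE.
Qed.

(** Following the curve into ever smaller pieces shows that the parameters of any two of its points
    are equal. The embedding is arbitrary because each step replaces it by its composite with some
    [shrink d]. *)
Lemma labyrinth_no_curve (g : R * R -> R * R) C : continuous g -> injective g ->
  simple_closed_curve C -> ~ (C `<=` g @` K).
Proof.
move=> cg injg scC CK.
have small n : forall h : R * R -> R * R, continuous h -> injective h ->
    C `<=` h @` K -> forall u v, C (h u) -> C (h v) -> dist_le (m%:R^-1 ^+ n) u v.
  elim: n => [|n IH] h ch injh hK u v hu hv.
    have [u' Ku' /injh <-] := hK _ hu; have [v' Kv' /injh <-] := hK _ hv.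
    by apply: dist_le1_unit_square;
      [exact: fractal_unit_square Ku'|exact: fractal_unit_square Kv'].
  have [d dD CKd] := curve_in_piece ch injh scC hK.
  have [u' _ /injh uu] := CKd _ hu; have [v' _ /injh vv] := CKd _ hv.
  rewrite -uu -vv in hu hv *; rewrite exprSr; apply: dist_le_shrink => //.
  apply: (IH (h \o shrink d)) => //.
    move=> z; apply: continuous_comp; last exact: ch.
    exact: (@shrink_continuous R m d z).
  by apply: inj_comp => //; exact: shrink_inj.
have [x [y [Cx Cy]]] := simple_closed_curve_points scC; apply.
have [u _ ux] := CK _ Cx; have [v _ vy] := CK _ Cy.
rewrite -ux -vy in Cx Cy *; congr g; apply: dist_le_eq => e e0.
have [n ne] := expVn_small m1 e0.
by have [h1 h2] := small n g cg injg CK u v Cx Cy; split;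
  [exact: le_trans h1 _|exact: le_trans h2 _].
Qed.

End Labyrinth.

(** * The chart of the quadrilateral *)


Section Chart.
Variables (R : realType) (Q : quad R).

(** Bilinear interpolation of the four vertex values, with [min x y] in place of the product of [x]
    and [y]. *)
Definition chart1 (a b c d x y : R) : R :=
  a + x * (b - a) + y * (d - a) + Order.min x y * (a - b + c - d).

(* The piecewise affine map of the plane sending the vertices of the unit
   square to those of [Q]; it is affine on either side of the diagonal. *)
Definition chart (z : R * R) : R * R :=
  (chart1 (qv1 Q).1 (qv2 Q).1 (qv3 Q).1 (qv4 Q).1 z.1 z.2,
   chart1 (qv1 Q).2 (qv2 Q).2 (qv3 Q).2 (qv4 Q).2 z.1 z.2).

Lemma chart1_lower a b c d x y : y <= x ->
  chart1 a b c d x y = (1 - x) * a + (x - y) * b + y * c.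
Proof. by move=> yx; rewrite /chart1 min_r //; ring. Qed.

Lemma chart1_upper a b c d x y : x <= y ->
  chart1 a b c d x y = (1 - y) * a + x * c + (y - x) * d.
Proof. by move=> xy; rewrite /chart1 min_l //; ring. Qed.

(** No half cell of the grid crosses the diagonal of the unit square, so the chart is affine on each
    half cell. *)
Lemma chart1_cell_lower a b c d (I J : nat) (s u v : R) : 0 <= s ->
  0 <= v -> v <= u -> u <= 1 ->
  (1 - u) * chart1 a b c d (I%:R * s) (J%:R * s)
  + (u - v) * chart1 a b c d (I.+1%:R * s) (J%:R * s)
  + v * chart1 a b c d (I.+1%:R * s) (J.+1%:R * s)
  = chart1 a b c d ((I%:R + u) * s) ((J%:R + v) * s).
Proof.
move=> s0 v0 vu u1; rewrite -!natr1.
have le (e f : R) : e <= f -> e * s <= f * s by move=> ?; exact: ler_wpM2r.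
have [IJ|JI] := ltnP I J.
  have {}IJ : I%:R + 1 <= J%:R :> R by rewrite natr1 ler_nat.
  by rewrite !chart1_upper; first (by ring); apply: le; lra.
have {}JI : J%:R <= I%:R :> R by rewrite ler_nat.
by rewrite !chart1_lower; first (by ring); apply: le; lra.
Qed.

Lemma chart1_cell_upper a b c d (I J : nat) (s u v : R) : 0 <= s ->
  0 <= u -> u <= v -> v <= 1 ->
  (1 - v) * chart1 a b c d (I%:R * s) (J%:R * s)
  + u * chart1 a b c d (I.+1%:R * s) (J.+1%:R * s)
  + (v - u) * chart1 a b c d (I%:R * s) (J.+1%:R * s)
  = chart1 a b c d ((I%:R + u) * s) ((J%:R + v) * s).
Proof.
move=> s0 u0 uv v1; rewrite -!natr1.
have le (e f : R) : e <= f -> e * s <= f * s by move=> ?; exact: ler_wpM2r.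
have [JI|IJ] := ltnP J I.
  have {}JI : J%:R + 1 <= I%:R :> R by rewrite natr1 ler_nat.
  by rewrite !chart1_lower; first (by ring); apply: le; lra.
have {}IJ : I%:R <= J%:R :> R by rewrite ler_nat.
by rewrite !chart1_upper; first (by ring); apply: le; lra.
Qed.

Lemma chart_continuous : continuous chart.
Proof.
have mc : continuous (fun z : R * R => Order.min z.1 z.2).
  move=> z; apply: (@continuous_min R _ fst snd); first exact: fst_cont.
  exact: snd_cont.
have c1 a b c d : continuous (fun z : R * R => chart1 a b c d z.1 z.2).
  move=> z; apply: cvgD; last by apply: cvgM; [exact: mc|exact: cvg_cst].
  apply: cvgD; last by apply: cvgM; [exact: snd_cont|exact: cvg_cst].
  apply: cvgD; first exact: cvg_cst.
  by apply: cvgM; [exact: fst_cont|exact: cvg_cst].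
by apply: pair_continuous; exact: c1.
Qed.

Lemma chart_lower x y : y <= x ->
  chart (x, y) = (1 - x) *: qv1 Q + (x - y) *: qv2 Q + y *: qv3 Q.
Proof. by move=> yx; rewrite /chart /= !chart1_lower. Qed.

Lemma chart_upper x y : x <= y ->
  chart (x, y) = (1 - y) *: qv1 Q + x *: qv3 Q + (y - x) *: qv4 Q.
Proof. by move=> xy; rewrite /chart /= !chart1_upper. Qed.

Definition grid (N I J : nat) : R * R := (I%:R * N%:R^-1, J%:R * N%:R^-1).

Definition grid_quad (N I J : nat) : quad R :=
  Quad (chart (grid N I J)) (chart (grid N I.+1 J))
       (chart (grid N I.+1 J.+1)) (chart (grid N I J.+1)).

Definition grid_cell (N I J : nat) (u : R * R) : R * R :=
  ((I%:R + u.1) * N%:R^-1, (J%:R + u.2) * N%:R^-1).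

Lemma grid_cell_lower N I J (u v : R) : 0 <= v -> v <= u -> u <= 1 ->
  let V := grid_quad N I J in
  (1 - u) *: qv1 V + (u - v) *: qv2 V + v *: qv3 V = chart (grid_cell N I J (u, v)).
Proof.
move=> v0 vu u1 /=; have s0 : 0 <= N%:R^-1 :> R by rewrite invr_ge0.
by rewrite /chart /= -!(@chart1_cell_lower _ _ _ _ I J _ u v).
Qed.

Lemma grid_cell_upper N I J (u v : R) : 0 <= u -> u <= v -> v <= 1 ->
  let V := grid_quad N I J in
  (1 - v) *: qv1 V + u *: qv3 V + (v - u) *: qv4 V = chart (grid_cell N I J (u, v)).
Proof.
move=> u0 uv v1 /=; have s0 : 0 <= N%:R^-1 :> R by rewrite invr_ge0.
by rewrite /chart /= -!(@chart1_cell_upper _ _ _ _ I J _ u v).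
Qed.

Lemma region_grid_quad N I J :
  region (grid_quad N I J) = chart @` (grid_cell N I J @` @unit_square R).
Proof.
apply/seteqP; split=> x.
  move=> [] [l1 [l2 [l3 [h1 h2 h3 hs ->]]]].
    (* At local coordinates [(u, v)], the lower triangle has weights [1 - u], [u - v], [v]; the
       upper one, listed from the third vertex, has weights [u], [v - u], [1 - v]. *)
    exists (grid_cell N I J (l2 + l3, l3)).
      by exists (l2 + l3, l3) => //; split=> /=; apply/andP; split; lra.
    rewrite -grid_cell_lower; [|lra..].
    by congr (_ *: _ + _ *: _ + _); lra.
  exists (grid_cell N I J (l1, l1 + l2)).
    by exists (l1, l1 + l2) => //; split=> /=; apply/andP; split; lra.
  rewrite -grid_cell_upper; [|lra..].
  rewrite -addrA addrC; congr (_ *: _ + _ *: _ + _ *: _); lra.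
move=> [_ [[u v] [/= /andP[u0 u1] /andP[v0 v1]] <-] <-].
have [vu|uv] := leP v u.
  left; exists (1 - u), (u - v), v; rewrite grid_cell_lower //.
  by split=> //; lra.
right; exists u, (v - u), (1 - v); rewrite -grid_cell_upper ?(ltW uv) //.
split=> //; [lra|lra|lra|].
by rewrite -addrA addrC.
Qed.

Hypothesis a123 : 0 < area2 (qv1 Q) (qv2 Q) (qv3 Q).
Hypothesis a341 : 0 < area2 (qv3 Q) (qv4 Q) (qv1 Q).

(** On either side of the diagonal the chart is affine with positive determinant, and the
    orientations place the two image half planes on opposite sides of the line through [qv1 Q] and
    [qv3 Q]. *)
Lemma chart_inj : injective chart.
Proof.
move: a123 a341; rewrite /area2 /cross /chart.
case: Q => -[p1 p1'] [p2 p2'] [p3 p3'] [p4 p4'] /= d1 d2.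
set D1 := (X in 0 < X) in d1; set D2 := (X in 0 < X) in d2.
have n1 : D1 != 0 by rewrite gt_eqF.
have n2 : D2 != 0 by rewrite gt_eqF.
have low (x y x' y' : R) : y <= x -> y' <= x' ->
    chart1 p1 p2 p3 p4 x y = chart1 p1 p2 p3 p4 x' y' ->
    chart1 p1' p2' p3' p4' x y = chart1 p1' p2' p3' p4' x' y' -> (x, y) = (x', y').
  move=> yx yx'; rewrite !chart1_lower // => e1 e2.
  (* Cramer's rule: the cross product with an edge vector at [qv1 Q] isolates one unknown. *)
  have ey : D1 * y = D1 * y'.
    by rewrite /D1; move: (congr1 (fun t => t * (p2' - p1')) e1)
      (congr1 (fun t => t * (p2 - p1)) e2) => /=; lra.
  have ex : D1 * (x - y) = D1 * (x' - y').
    by rewrite /D1; move: (congr1 (fun t => t * (p3' - p1')) e1)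
      (congr1 (fun t => t * (p3 - p1)) e2) => /=; lra.
  by move: (mulfI n1 ey) (mulfI n1 ex) => hy hx; congr pair; lra.
have upp (x y x' y' : R) : x <= y -> x' <= y' ->
    chart1 p1 p2 p3 p4 x y = chart1 p1 p2 p3 p4 x' y' ->
    chart1 p1' p2' p3' p4' x y = chart1 p1' p2' p3' p4' x' y' -> (x, y) = (x', y').
  move=> yx yx'; rewrite !chart1_upper // => e1 e2.
  have ey : D2 * x = D2 * x'.
    by rewrite /D2; move: (congr1 (fun t => t * (p4' - p1')) e1)
      (congr1 (fun t => t * (p4 - p1)) e2) => /=; lra.
  have ex : D2 * (y - x) = D2 * (y' - x').
    by rewrite /D2; move: (congr1 (fun t => t * (p3' - p1')) e1)
      (congr1 (fun t => t * (p3 - p1)) e2) => /=; lra.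
  by move: (mulfI n2 ey) (mulfI n2 ex) => hy hx; congr pair; lra.
(* Twice the signed area of [Q1, z, Q3] tells the two half planes apart. *)
have mix (x y x' y' : R) : y <= x -> x' <= y' ->
    chart1 p1 p2 p3 p4 x y = chart1 p1 p2 p3 p4 x' y' ->
    chart1 p1' p2' p3' p4' x y = chart1 p1' p2' p3' p4' x' y' -> (x, y) = (x', y').
  move=> yx xy' e1 e2; suff xy : x <= y by exact: upp.
  move: e1 e2; rewrite !(chart1_lower _ _ _ _ yx) !(chart1_upper _ _ _ _ xy') => e1 e2.
  have e : D1 * (x - y) + D2 * (y' - x') = 0.
    by rewrite /D1 /D2; move: (congr1 (fun t => t * (p3' - p1')) e1)
      (congr1 (fun t => t * (p3 - p1)) e2) => /=; lra.
  have h2 : 0 <= D2 * (y' - x') by apply: mulr_ge0; [exact: ltW|rewrite subr_ge0].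
  have : D1 * (x - y) <= 0 by lra.
  by rewrite pmulr_rle0 // subr_le0.
move=> [x y] [x' y'] /= [e1 e2].
have [yx|/ltW xy] := leP y x; have [yx'|/ltW xy'] := leP y' x'.
- exact: low.
- exact: mix.
- by apply/esym; apply: mix.
- exact: upp.
Qed.

End Chart.


(** * Grid cells: the quadrilaterals [Sm], the maps [PV], and adjacency *)

Section Grid.
Variables (R : realType) (Q : quad R).
(** The vertices of [Q] come from (0, 0), (1, 0), (1, 1), (0, 1), so the abscissa collects the
    weights of the second and third, the ordinate those of the third and fourth. *)
Lemma comb_lower m a1 a2 a3 : (0 < m)%N -> (a1 + a2 + a3 = m)%N ->
  comb Q m a1 a2 a3 0 = chart Q (grid R m (a2 + a3) a3).
Proof.
move=> m0 am; have mR : m%:R != 0 :> R by rewrite pnatr_eq0; lia.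
rewrite /grid chart_lower; last by rewrite ler_wpM2r ?invr_ge0 // ler_nat leq_addl.
have -> : 1 - (a2 + a3)%:R / m%:R = m%:R^-1 * a1%:R :> R.
  by rewrite -am !natrD; field; rewrite -!natrD am.
have -> : (a2 + a3)%:R / m%:R - a3%:R / m%:R = m%:R^-1 * a2%:R :> R by rewrite natrD; ring.
by rewrite /comb scale0r addr0 !scalerDr !scalerA [_ / _]mulrC.
Qed.

Lemma comb_upper m a1 a3 a4 : (0 < m)%N -> (a1 + a3 + a4 = m)%N ->
  comb Q m a1 0 a3 a4 = chart Q (grid R m a3 (a3 + a4)).
Proof.
move=> m0 am; have mR : m%:R != 0 :> R by rewrite pnatr_eq0; lia.
rewrite /grid chart_upper; last by rewrite ler_wpM2r ?invr_ge0 // ler_nat leq_addr.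
have -> : 1 - (a3 + a4)%:R / m%:R = m%:R^-1 * a1%:R :> R.
  by rewrite -am !natrD; field; rewrite -!natrD am.
have -> : (a3 + a4)%:R / m%:R - a3%:R / m%:R = m%:R^-1 * a4%:R :> R by rewrite natrD; ring.
by rewrite /comb scale0r addr0 !scalerDr !scalerA [_ / _]mulrC.
Qed.

Lemma Sm_grid m k1 k2 k3 k4 : (0 < m)%N -> inA m (k1, k2, k3, k4) ->
  Sm Q m (k1, k2, k3, k4) = grid_quad Q m (k2 + k3) (k3 + k4).
Proof.
move=> m0 [ks k24]; rewrite /Sm.
case: ifP => [/andP[/eqP k40 k20]|nA1].
  subst k4; rewrite !comb_lower; [|lia..].
  by rewrite /grid_quad; congr (Quad (chart _ (grid _ _ _ _)) (chart _ (grid _ _ _ _))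
    (chart _ (grid _ _ _ _)) (chart _ (grid _ _ _ _))); lia.
case: ifP => [/andP[/eqP k20 k40]|nA2].
  subst k2; rewrite !comb_upper; [|lia..].
  by rewrite /grid_quad; congr (Quad (chart _ (grid _ _ _ _)) (chart _ (grid _ _ _ _))
    (chart _ (grid _ _ _ _)) (chart _ (grid _ _ _ _))); lia.
have [? ?] : k2 = 0%N /\ k4 = 0%N by lia.
(* The cell straddles the diagonal, and only its fourth vertex lies strictly above it. *)
subst k2 k4; rewrite [comb Q m k1 0 k3 1]comb_upper; [|lia..].
rewrite !comb_lower; [|lia..].
by rewrite /grid_quad; congr (Quad (chart _ (grid _ _ _ _)) (chart _ (grid _ _ _ _))
    (chart _ (grid _ _ _ _)) (chart _ (grid _ _ _ _))); lia.
Qed.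

Lemma grid_inj m i j i' j' : (0 < m)%N ->
  grid R m i j = grid R m i' j' -> i = i' /\ j = j'.
Proof.
move=> m0 [/mulIf e1 /mulIf e2].
have mi : m%:R^-1 != 0 :> R by rewrite invr_eq0 pnatr_eq0; lia.
by move: (e1 mi) (e2 mi) => /eqP + /eqP; rewrite !eqr_nat => /eqP -> /eqP ->.
Qed.

Lemma segment_sym (a b : R * R) : segment a b = segment b a.
Proof.
suff h (c d : R * R) : segment c d `<=` segment d c by apply/seteqP; split.
move=> _ [t [t0 t1 ->]]; exists (1 - t); split; [lra|lra|].
by rewrite subKr addrC.
Qed.

Lemma segmentL (a b : R * R) : segment a b a.
Proof. by exists 0; split=> //; rewrite subr0 scale1r scale0r addr0. Qed.

Lemma segmentR (a b : R * R) : segment a b b.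
Proof. by exists 1; split=> //; rewrite subrr scale1r scale0r add0r. Qed.

Lemma side_region (V : quad R) i : side V i `<=` region V.
Proof.
case: i => [|[|[|i]]] x [t [t0 t1 ->]].
- left; exists (1 - t), t, 0; split=> //; [lra|lra|by rewrite scale0r addr0].
- left; exists 0, (1 - t), t; split=> //; [lra|lra|by rewrite scale0r add0r].
- right; exists (1 - t), t, 0; split=> //; [lra|lra|by rewrite scale0r addr0].
- right; exists 0, (1 - t), t; split=> //; [lra|lra|by rewrite scale0r add0r].
Qed.

Hypothesis a123 : 0 < area2 (qv1 Q) (qv2 Q) (qv3 Q).
Hypothesis a341 : 0 < area2 (qv3 Q) (qv4 Q) (qv1 Q).

Lemma bary1_chart_lower (x y : R) : y <= x -> bary1 Q (chart Q (x, y)) = (1 - x, x - y, y).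
Proof.
move=> yx; rewrite /bary1 /chart /= !chart1_lower //.
move: a123; rewrite /area2 /cross; case: Q => -[p1 p1'] [p2 p2'] [p3 p3'] [p4 p4'] /=.
by move=> /lt0r_neq0 d; congr (_, _, _); field.
Qed.

Lemma bary2_chart_upper (x y : R) : x <= y -> bary2 Q (chart Q (x, y)) = (x, y - x, 1 - y).
Proof.
move=> xy; rewrite /bary2 /chart /= !chart1_upper //.
move: a341; rewrite /area2 /cross; case: Q => -[p1 p1'] [p2 p2'] [p3 p3'] [p4 p4'] /=.
by move=> /lt0r_neq0 d; congr (_, _, _); field.
Qed.

(** The second barycentric coordinate has the sign of [x - y]. The inequality is strict because [PV]
    treats the diagonal as part of the first triangle. *)
Lemma in_delta1_chart_upper (x y : R) : x < y -> in_delta1 Q (chart Q (x, y)) = false.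
Proof.
move=> xy; rewrite /in_delta1 /bary1 /=; apply/negP => /and3P[_ + _].
rewrite pmulr_lge0 ?invr_gt0 //; apply/negP; rewrite -ltNge.
have -> : area2 (qv1 Q) (chart Q (x, y)) (qv3 Q)
    = (x - y) * area2 (qv3 Q) (qv4 Q) (qv1 Q).
  rewrite /chart /= !chart1_upper ?(ltW xy) // /area2 /cross.
  by case: Q => -[p1 p1'] [p2 p2'] [p3 p3'] [p4 p4'] /=; ring.
by rewrite pmulr_llt0 // subr_lt0.
Qed.

Lemma PV_chart_lower (V : quad R) (x y : R) : 0 <= y -> y <= x -> x <= 1 ->
  PV Q V (chart Q (x, y)) = (1 - x) *: qv1 V + (x - y) *: qv2 V + y *: qv3 V.
Proof.
move=> y0 yx x1; rewrite /PV /in_delta1 bary1_chart_lower // !subr_ge0.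
by rewrite x1 yx y0.
Qed.

Lemma PV_chart_upper (V : quad R) (x y : R) : x < y ->
  PV Q V (chart Q (x, y)) = (1 - y) *: qv1 V + x *: qv3 V + (y - x) *: qv4 V.
Proof.
by move=> xy; rewrite /PV in_delta1_chart_upper // bary2_chart_upper // ltW.
Qed.

(** Read through the chart, [PV] for a grid cell is the homothety of the unit square onto that cell;
    only its values at grid vertices are needed to follow quadrilaterals. *)
Lemma PV_grid (N m I J i j : nat) : (0 < m)%N -> (i <= m)%N -> (j <= m)%N ->
  PV Q (grid_quad Q N I J) (chart Q (grid R m i j))
  = chart Q (grid R (N * m) (I * m + i) (J * m + j)).
Proof.
move=> m0 im jm; have mR : 0 < m%:R :> R by rewrite ltr0n.
have gE : grid R (N * m) (I * m + i) (J * m + j)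
    = grid_cell N I J (i%:R / m%:R, j%:R / m%:R).
  have mn : m%:R != 0 :> R by rewrite gt_eqF.
  rewrite /grid /grid_cell /= natrM invfM !natrD !natrM.
  by congr pair; rewrite [N%:R^-1 * _]mulrC mulrA mulrDl mulfK.
have bound k : (k <= m)%N -> k%:R / m%:R <= 1 :> R.
  by move=> km; rewrite ler_pdivrMr // mul1r ler_nat.
rewrite gE /grid; have [ji|ij] := leqP j i.
  have h : j%:R / m%:R <= i%:R / m%:R :> R by rewrite ler_pM2r ?invr_gt0 // ler_nat.
  rewrite PV_chart_lower ?grid_cell_lower //; exact: bound.
have h : i%:R / m%:R < j%:R / m%:R :> R by rewrite ltr_pM2r ?invr_gt0 // ltr_nat.
rewrite PV_chart_upper // grid_cell_upper ?(ltW h) //; exact: bound.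
Qed.

Lemma Pquad_grid (N m I J i j : nat) : (i < m)%N -> (j < m)%N ->
  Pquad Q (grid_quad Q N I J) (grid_quad Q m i j)
  = grid_quad Q (N * m) (I * m + i) (J * m + j).
Proof.
move=> im jm; have m0 : (0 < m)%N by lia.
by rewrite /Pquad /= !PV_grid ?(ltnW im) ?(ltnW jm) // /grid_quad -!addnS.
Qed.

Lemma grid_quad_inj m i j i' j' : (0 < m)%N ->
  grid_quad Q m i j = grid_quad Q m i' j' -> i = i' /\ j = j'.
Proof. by move=> m0 /(congr1 (@qv1 R))/(chart_inj a123 a341)/(grid_inj m0). Qed.

Lemma grid_region m i j a b : (0 < m)%N ->
  region (grid_quad Q m i j) (chart Q (grid R m a b)) ->
  (i <= a <= i.+1)%N /\ (j <= b <= j.+1)%N.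
Proof.
move=> m0; rewrite region_grid_quad => -[_ [u [u1 u2] <-] /(chart_inj a123 a341)].
have mi : m%:R^-1 != 0 :> R by rewrite invr_eq0 pnatr_eq0; lia.
move=> [/(mulIf mi) e1 /(mulIf mi) e2].
by rewrite -!(ler_nat R) -e1 -e2 -!natr1; split; apply/andP; split; lra.
Qed.

Lemma side_adjacentP m (d d' : 'I_m * 'I_m) :
  side_adjacent d d' <->
  Defs.adjacent (grid_quad Q m d.1 d.2) (grid_quad Q m d'.1 d'.2).
Proof.
have m0 : (0 < m)%N by case: d => -[i im] _; lia.
case: d => i j; case: d' => i' j' /=; rewrite /side_adjacent /=.
split=> [dd|[ne [k [l [k4 [l4 kl]]]]]].
  split; first by move=> /(grid_quad_inj m0)[? ?]; lia.
  move: dd => /orP[]/andP[/eqP e /orP[]/eqP f].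
  - by exists 0%N, 2%N; do 2!split=> //; rewrite /= segment_sym e f.
  - by exists 2%N, 0%N; do 2!split=> //; rewrite /= segment_sym e f.
  - by exists 3%N, 1%N; do 2!split=> //; rewrite /= segment_sym e f.
  - by exists 1%N, 3%N; do 2!split=> //; rewrite /= segment_sym e f.
(* The two ends of the common side are grid vertices lying in the other cell, which confines the
   indices of that cell. *)
have in_cell a b : side (grid_quad Q m i j) k (chart Q (grid R m a b)) ->
    (i' <= a <= i'.+1)%N /\ (j' <= b <= j'.+1)%N.
  by rewrite kl => /side_region /(grid_region m0).
have neq : ~ (i = i' :> nat /\ j = j' :> nat).
  by move=> [e f]; apply: ne; rewrite e f.
case: k k4 in_cell {kl} => [|[|[|[|//]]]] _ in_cell.
- have := in_cell i j (segmentL _ _); have := in_cell i.+1 j (segmentR _ _); lia.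
- have := in_cell i.+1 j (segmentL _ _); have := in_cell i.+1 j.+1 (segmentR _ _); lia.
- have := in_cell i.+1 j.+1 (segmentL _ _); have := in_cell i j.+1 (segmentR _ _); lia.
- have := in_cell i j.+1 (segmentL _ _); have := in_cell i j (segmentR _ _); lia.
Qed.

End Grid.

(** * Levels of the quadrilateral fractal *)


Section Levels.
Variables (R : realType) (Q : quad R) (m : nat) (W1 : set (quad R)).
Hypothesis a123 : 0 < area2 (qv1 Q) (qv2 Q) (qv3 Q).
Hypothesis a341 : 0 < area2 (qv3 Q) (qv4 Q) (qv1 Q).
Hypothesis m1 : (1 < m)%N.
Hypothesis W1S : W1 `<=` Sset Q m.
Local Notation cell := ('I_m * 'I_m)%type.

Let m0 : (0 < m)%N. Proof. by apply: ltnW. Qed.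

Definition digits : {set cell} := [set d : cell | `[< W1 (grid_quad Q m d.1 d.2) >]]%SET.

Lemma digitsP (d : cell) : (d \in digits) <-> W1 (grid_quad Q m d.1 d.2).
Proof. by rewrite finset.inE; split=> /asboolP. Qed.

Lemma W1_digits V : W1 V -> exists2 d : cell, d \in digits & V = grid_quad Q m d.1 d.2.
Proof.
move=> W1V; have [[[[k1 k2] k3] k4] Ak VE] := W1S W1V.
rewrite Sm_grid // in VE; case: (Ak) => ks k24.
have im : (k2 + k3 < m)%N by lia.
have jm : (k3 + k4 < m)%N by lia.
exists (Ordinal im, Ordinal jm); last by rewrite -VE.
by apply/digitsP; rewrite /= VE.
Qed.

Lemma cell_in_digits i j : (i < m)%N -> (j < m)%N ->
  cell_in digits i j <-> W1 (grid_quad Q m i j).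
Proof.
move=> im jm; split=> [[d /digitsP dD [<- <-]] //|h].
by exists (Ordinal im, Ordinal jm) => //; exact/digitsP.
Qed.

(** Positions of the cells of [Wlev n] in the grid of step [m ^ n.+1]: both coordinates have [n.+1]
    base-[m] digits, since [Wlev 0] is already the pattern. *)
Fixpoint level n : set (nat * nat) :=
  match n with
  | 0 => [set p | exists2 d, d \in digits & p = (d.1 : nat, d.2 : nat)]
  | n'.+1 => [set p | exists q d, [/\ level n' q, d \in digits &
                p = (q.1 * m + d.1, q.2 * m + d.2)%N]]
  end.

Lemma Wlev_level n :
  Wlev Q W1 n = [set grid_quad Q (m ^ n.+1) p.1 p.2 | p in level n].
Proof.
elim: n => [|n IH] /=.
  apply/seteqP; split=> [V /W1_digits[d dD ->]|_ [_ [d /digitsP dD ->] <-]].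
    by exists (d.1 : nat, d.2 : nat); [exists d|rewrite expn1].
  by rewrite expn1.
rewrite IH; apply/seteqP; split=> V.
  move=> [_ [_ [[p pn <-] /W1_digits[d dD ->] ->]]].
  exists (p.1 * m + d.1, p.2 * m + d.2)%N; first by exists p, d.
  by rewrite Pquad_grid // -expnSr.
move=> [_ [p [d [pn dD ->]]] <-].
exists (grid_quad Q (m ^ n.+1) p.1 p.2), (grid_quad Q m d.1 d.2); split.
- by exists p.
- exact/digitsP.
- by rewrite Pquad_grid // -expnSr.
Qed.

Lemma grid_cell_shrink N I J (d : cell) (u : R * R) :
  grid_cell N I J (shrink d u) = grid_cell (N * m) (I * m + d.1) (J * m + d.2) u.
Proof.
have mR : m%:R != 0 :> R by rewrite pnatr_eq0; lia.
rewrite /grid_cell /shrink /= natrM invfM !natrD !natrM.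
by congr pair; rewrite [N%:R^-1 * _]mulrC mulrA; congr (_ * _); field.
Qed.

(** [level] appends digits at the fine end, which matches the innermost application of [refine]; the
    induction therefore replaces [X] by [refine digits X]. *)
Lemma level_refine n (X : set (R * R)) :
  \bigcup_(p in level n) (grid_cell (m ^ n.+1) p.1 p.2 @` X)
  = iter n.+1 (refine digits) X.
Proof.
elim: n X => [|n IH] X.
  rewrite /= expn1; apply/seteqP; split=> z.
    by move=> [_ [d dD ->] [u Xu <-]]; exists d => //; exists u.
  by move=> [d dD [u Xu ->]]; exists (d.1 : nat, d.2 : nat); [exists d|exists u].
rewrite iterSr -IH; apply/seteqP; split=> z.
  move=> [_ [p [d [pn dD ->]]] [u Xu <-]]; exists p => //.
  exists (shrink d u); first by exists d => //; exists u.
  by rewrite grid_cell_shrink -expnSr.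
move=> [p pn [_ [d dD [u Xu ->]] <-]].
exists (p.1 * m + d.1, p.2 * m + d.2)%N; first by exists p, d.
by exists u => //; rewrite grid_cell_shrink -expnSr.
Qed.

Lemma Llev_refine n :
  Llev Q W1 n = chart Q @` iter n.+1 (refine digits) (@unit_square R).
Proof.
rewrite -level_refine /Llev Wlev_level; apply/seteqP; split=> z.
  move=> [_ [p pn <-]]; rewrite region_grid_quad => -[w [u uS uw] wz].
  by exists w => //; exists p => //; exists u.
move=> [w [p pn uw] wz]; exists (grid_quad Q (m ^ n.+1) p.1 p.2); first by exists p.
by rewrite region_grid_quad; exists w.
Qed.

(** Injectivity of the chart lets the image commute with the intersection: the preimage found at the
    first level serves at all levels. *)
Lemma Linf_fractal : Linf Q W1 = chart Q @` square_fractal digits.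
Proof.
apply/seteqP; split=> [z Lz|_ [u Ku <-] n _]; last first.
  by rewrite Llev_refine; exists u => //; exact: Ku.
have := Lz 0%N I; rewrite Llev_refine => -[u u1 uz]; exists u => // -[|n] _.
  exact: (iter_refine_decr (leq0n 1) u1).
have := Lz n I; rewrite Llev_refine => -[v vn].
by rewrite -uz => /(chart_inj a123 a341) <-.
Qed.

Lemma adj_path_digits (d : cell) (p : seq (quad R)) :
  adj_path (grid_quad Q m d.1 d.2) p -> (forall V, List.In V p -> W1 V) ->
  exists q : seq cell, [/\ path (@side_adjacent m) d q, {subset q <= digits} &
    last (grid_quad Q m d.1 d.2) p
    = grid_quad Q m (last d q).1 (last d q).2].
Proof.
elim: p d => [|V p IH] d /=; first by exists [::].
move=> [dV Vp] pW; have [b bD VE] := W1_digits (pW V (or_introl erefl)).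
rewrite VE in dV Vp *.
have [q [dq qD lq]] := IH b Vp (fun U Up => pW U (or_intror Up)).
exists (b :: q); split => //=.
  by rewrite dq andbT; apply/(side_adjacentP a123 a341).
by move=> x; rewrite inE => /predU1P[->|/qD].
Qed.

Lemma digits_paths : graph_connected W1 ->
  forall d d', d \in digits -> d' \in digits -> exists p,
  [/\ path (@side_adjacent m) d p, {subset p <= digits} & last d p = d'].
Proof.
move=> cW d d' /digitsP dW /digitsP d'W.
have [p [dp pW lp]] := cW _ _ dW d'W.
have [q [dq qD lq]] := adj_path_digits dp pW.
exists q; split=> //; move: lq; rewrite lp => /(grid_quad_inj a123 a341 m0)[].
by case: (last d q) d' {d'W lp} => [a b] [a' b'] /= /val_inj -> /val_inj ->.
Qed.

Lemma In_map_digits (q : seq cell) V :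
  List.In V [seq grid_quad Q m d.1 d.2 | d : cell <- q] ->
  exists2 d, d \in q & V = grid_quad Q m d.1 d.2.
Proof.
elim: q => //= a q IH [<-|/IH[d dq ->]]; first by exists a; rewrite ?mem_head.
by exists d; rewrite // inE dq orbT.
Qed.

Lemma adj_path_map (d : cell) q : path (@side_adjacent m) d q ->
  adj_path (grid_quad Q m d.1 d.2) [seq grid_quad Q m b.1 b.2 | b : cell <- q].
Proof.
elim: q d => //= b q IH d /andP[db bq]; split; last exact: IH.
exact/(side_adjacentP a123 a341).
Qed.

Lemma digits_acyclic : ~ has_cycle W1 -> acyclic (@side_adjacent m) digits.
Proof.
move=> nc x p sp up pD pp lx; apply: nc.
exists (grid_quad Q m x.1 x.2), [seq grid_quad Q m b.1 b.2 | b : cell <- p]; split.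
- by rewrite size_map.
- suff h (q : seq cell) : uniq q -> List.NoDup [seq grid_quad Q m b.1 b.2 | b : cell <- q].
    exact: (h (x :: p)).
  elim: q => [|a q IH] /=; first by move=> _; exact: List.NoDup_nil.
  move=> /andP[aq uq]; apply: List.NoDup_cons; last exact: IH.
  move=> /In_map_digits[[b1 b2] bq /(grid_quad_inj a123 a341 m0)[]].
  case: a aq => a1 a2 aq /= /val_inj e1 /val_inj e2.
  by rewrite e1 e2 bq in aq.
- move=> V /(@In_map_digits (x :: p))[d dxp ->].
  by apply/digitsP; exact: pD.
- exact: adj_path_map.
- by rewrite (last_map (fun b : cell => grid_quad Q m b.1 b.2));
    apply/(side_adjacentP a123 a341).
Qed.

End Levels.

(** * Transfer of the dendrite properties from the square to the quadrilateral *)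

Theorem theorem4p1 (R : realType) (Q : quad R) (m : nat) (W1 : set (quad R)) :
  convex_ccw Q -> shorter_diag13 Q -> (4 <= m)%N ->
  labyrinth_set Q m W1 ->
  dendrite (Linf Q W1).
Proof.
move=> [a123 _ a341 _] _ m4 [_ W1S [_ [cW ncW]] [colE rowE] [cornerD cornerA]].
have m1 : (1 < m)%N by lia.
have m0 : (0 < m)%N by lia.
have inD := @cell_in_digits R Q m W1.
pose D := digits Q m W1.
have lastm : (m.-1 < m)%N by lia.
have Sm1 := fun k1 k2 k3 k4 => @Sm_grid R Q m k1 k2 k3 k4 m0.
(* The four quadrilaterals of the corner property are the corner cells of the grid, in diagonal and
   antidiagonal pairs. *)
rewrite !Sm1 /= ?addn0 ?add0n in cornerD cornerA; [|by split; [lia|left+right]..].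
have diag : ~ (cell_in D 0 0 /\ cell_in D m.-1 m.-1).
  by rewrite !inD.
have antidiag : ~ (cell_in D m.-1 0 /\ cell_in D 0 m.-1).
  by rewrite !inD.
(* The indices [(k1, k2, 0, 0)] and [(0, 0, k2, k1)] give the bottom and top cells of column
   [k2]. *)
have [c [cB cT cU]] : exists c, [/\ cell_in D c 0, cell_in D c m.-1 &
    forall i, cell_in D i m.-1 -> cell_in D i 0 -> i = c].
  have [[k1 k2] [[Ak [h1 h2]] un]] := colE.
  have ks : (k1 + k2 = m.-1)%N by case: Ak => /=; lia.
  rewrite Sm1 /= ?addn0 in h1; last by split; [lia|right].
  rewrite Sm1 /= ?add0n ?[(k2 + k1)%N]addnC ?ks in h2; last by split; [lia|left].
  exists k2; split; [by apply/inD => //; lia|by apply/inD => //; lia|].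
  move=> i iT iB; have im : (i < m)%N by case: iB => -[a b] _ /= [<- _].
  have [_ ->] // : (k1, k2) = (m.-1 - i, i)%N.
  apply: un; split; first by split; [rewrite /=; lia|right].
  rewrite /fst /snd !Sm1 ?addn0 ?add0n ?subnKC;
    try by [lia|split; [lia|by [left|right]]].
  by split; apply/inD.
(* The indices [(k1, 0, 0, k2)] and [(0, k1, k2, 0)] give the left and right cells of row [k2]. *)
have [r [rL rR rU]] : exists r, [/\ cell_in D 0 r, cell_in D m.-1 r &
    forall j, cell_in D m.-1 j -> cell_in D 0 j -> j = r].
  have [[k1 k2] [[Ak [h1 h2]] un]] := rowE.
  have ks : (k1 + k2 = m.-1)%N by case: Ak => /=; lia.
  rewrite Sm1 /= ?add0n in h1; last by split; [lia|left].
  rewrite Sm1 /= ?addn0 ?ks in h2; last by split; [lia|right].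
  exists k2; split; [by apply/inD => //; lia|by apply/inD => //; lia|].
  move=> j jR jL; have jm : (j < m)%N by case: jL => -[a b] _ /= [_ <-].
  have [_ ->] // : (k1, k2) = (m.-1 - j, j)%N.
  apply: un; split; first by split; [rewrite /=; lia|left].
  rewrite /fst /snd !Sm1 ?addn0 ?add0n ?subnK;
    try by [lia|split; [lia|by [left|right]]].
  by split; apply/inD.
have paths := digits_paths a123 a341 m1 W1S cW.
have acyc := digits_acyclic a123 a341 m1 ncW.
rewrite (Linf_fractal a123 a341 m1 W1S) -/D.
have cptK := @fractal_compact R m m1 D.
have conK : connected (@square_fractal R m D).
  exact: (labyrinth_connected m1 rL rR cB cT paths).
have cc := @chart_continuous R Q.
have ic := chart_inj a123 a341.
split.
- split.
  + have [K0 _ _ _] := @exits_in_fractal R m D r c m1 rL rR cB cT.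
    by eexists; exists (0, r%:R / (m%:R - 1)).
  + by apply: continuous_compact => //; exact: continuous_subspaceT.
  + by apply: connected_continuous_connected => //; exact: continuous_subspaceT.
- apply: locally_connected_image => //; exact: fractal_locally_connected.
- move=> [C [CL scC]].
  exact: (labyrinth_no_curve m1 diag antidiag rU cU acyc cc ic scC CL).
Qed.
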